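(* Let $A$ be a finite-dimensional unital associative algebra over a field $k$ with a linear splitting $A=k1\oplus A'$. Let $e_0=1$, let $\{e_i\}_{i=1,\dots,\dim(A)-1}$ be a basis of $A'$, and let $c_{ij}{}^k$ be the structure constants of $A$ in the basis $\{e_0\}\cup\{e_i\}$. Then the restricted comeasuring bialgebra $M_0(A)$ is the quotient of $M(A)$ by $b_i=0$ for all $i$; i.e. it is the associative algebra generated by $1$ and $t^i{}_j$, $i,j=1,\dots,\dim(A)-1$, with the relations (sums over $1,\dots,\dim(A)-1$) $$\sum_a c_{ij}{}^a t^k{}_a=\sum_{a,b}c_{ab}{}^kt^a{}_it^b{}_j,\qquad c_{ij}{}^0=\sum_{a,b}c_{ab}{}^0t^a{}_it^b{}_j$$ and the matrix coalgebra $\Delta t^i{}_j=\sum_at^i{}_a\otimes t^a{}_j$, $\epsilon(t^i{}_j)=\delta^i{}_j$. Its coaction is $\beta_U(e_i)=\sum_a e_a\otimes t^a{}_i$.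
   Context: The structure constants are defined by $e_ie_j=\sum_{k\ge0}c_{ij}{}^ke_k$. A comeasuring of a unital algebra $A$ is a pair $(B,\beta)$ with $B$ a unital algebra and $\beta:A\to A\otimes B$ a unital algebra map. Given the splitting $A=k1\oplus A'$, the restricted comeasuring bialgebra $(M_0(A),\beta_U)$ is the universal (initial) object among those comeasurings $(B,\beta)$ which respect the splitting, i.e. satisfy $\beta(A')\subset A'\otimes B$ in addition to $\beta(1)=1\otimes1$: for each such $(B,\beta)$ there is a unique unital algebra map $\pi:M_0(A)\to B$ with $\beta=(\mathrm{id}\otimes\pi)\beta_U$. The comeasuring bialgebra $M(A)$ (the initial object among all comeasurings) is the unital algebra generated by $b_i,t^i{}_j$, $1\le i,j\le\dim(A)-1$, with relations $\sum_a c_{ij}{}^at^k{}_a=\sum_{a,b}c_{ab}{}^kt^a{}_it^b{}_j+b_it^k{}_j+t^k{}_ib_j$ and $c_{ij}{}^0+\sum_ac_{ij}{}^ab_a=\sum_{a,b}c_{ab}{}^0t^a{}_it^b{}_j+b_ib_j$, with $\Delta t^i{}_j=\sum_at^i{}_a\otimes t^a{}_j$, $\Delta b_i=\sum_ab_a\otimes t^a{}_i+1\otimes b_i$, $\epsilon(t^i{}_j)=\delta^i{}_j$, $\epsilon(b_i)=0$, and coaction $\beta_U(e_i)=1\otimes b_i+\sum_ae_a\otimes t^a{}_i$. *)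

(* Defs.v *)
From HB Require Import structures.
From mathcomp Require Import all_boot all_order all_algebra all_field.
From mathcomp Require Import boolp.
From mathcomp Require Import monalg.

Set Implicit Arguments.
Unset Strict Implicit.
Unset Printing Implicit Defensive.

Import GRing.Theory.
Local Open Scope ring_scope.
Local Open Scope quotient_scope.

(* Unital associative algebras over k. Unlike [algType k], this structure     *)
(* allows the zero algebra, so that an algebra given by generators and        *)
(* relations is an instance without first having to be shown non-trivial.     *)
HB.mixin Record isUnitalAlg (k : fieldType) V of GRing.Lmodule k V := {
  amul : V -> V -> V;
  aone : V;
  amulA : associative amul;
  amul1l : left_id aone amul;
  amul1r : right_id aone amul;
  amulDl : left_distributive amul +%R;
  amulDr : right_distributive amul +%R;
  amulZl : forall (c : k) (x y : V), amul (c *: x) y = c *: amul x y;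
  amulZr : forall (c : k) (x y : V), amul x (c *: y) = c *: amul x y
}.

#[short(type="ualgType")]
HB.structure Definition UnitalAlg (k : fieldType) :=
  {V of GRing.Lmodule k V & isUnitalAlg k V}.

(* Every [V : ualgType k] is a ring, so that [*] and [1] can be used for it.  *)
HB.instance Definition _ (k : fieldType) (V : ualgType k) :=
  GRing.Zmodule_isPzRing.Build (UnitalAlg.sort V)
    (@amulA k V) (@amul1l k V) (@amul1r k V) (@amulDl k V) (@amulDr k V).

Lemma uscalerAl (k : fieldType) (V : ualgType k) (c : k) (x y : V) :
  c *: (x * y) = (c *: x) * y.
Proof. by rewrite -[RHS]/(amul _ _) amulZl. Qed.

Lemma uscalerAr (k : fieldType) (V : ualgType k) (c : k) (x y : V) :
  c *: (x * y) = x * (c *: y).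
Proof. by rewrite -[RHS]/(amul _ _) amulZr. Qed.

HB.instance Definition _ (k : fieldType) (A : falgType k) :=
  isUnitalAlg.Build k (Falgebra.sort A)
    (@mulrA A) (@mul1r A) (@mulr1 A) (@mulrDl A) (@mulrDr A)
    (fun c x y => esym (scalerAl c x y)) (fun c x y => esym (scalerAr c x y)).

HB.instance Definition _ (k : fieldType) :=
  isUnitalAlg.Build k k^o
    (@mulrA k) (@mul1r k) (@mulr1 k) (@mulrDl k) (@mulrDr k)
    (fun c x y => esym (mulrA c x y)) (fun c x y => mulrCA x c y).

Definition unital_algmap (k : fieldType) (A B : ualgType k) (f : A -> B) :=
  [/\ linear f, {morph f : x y / x * y} & f 1 = 1].

(* -------------------------------------------------------------------------- *)
(* Tensor products: formal sums a_1 (x) b_1 + ... + a_m (x) b_m, encoded as   *)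
(* sequences of pairs, modulo the least congruence making (x) bilinear.       *)

Section Tensor.
Variables (k : fieldType) (A B : ualgType k).

Inductive tens_eq : seq (A * B) -> seq (A * B) -> Prop :=
| tens_refl s : tens_eq s s
| tens_sym s1 s2 : tens_eq s1 s2 -> tens_eq s2 s1
| tens_trans s1 s2 s3 : tens_eq s1 s2 -> tens_eq s2 s3 -> tens_eq s1 s3
| tens_cat s1 s2 s3 s4 :
    tens_eq s1 s2 -> tens_eq s3 s4 -> tens_eq (s1 ++ s3) (s2 ++ s4)
| tens_catC s1 s2 : tens_eq (s1 ++ s2) (s2 ++ s1)
| tens_addl a a' b : tens_eq [:: (a + a', b)] [:: (a, b); (a', b)]
| tens_addr a b b' : tens_eq [:: (a, b + b')] [:: (a, b); (a, b')]
| tens_scale c a b : tens_eq [:: (c *: a, b)] [:: (a, c *: b)]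
| tens_zero b : tens_eq [:: (0, b)] [::].

Definition tens_rel (s1 s2 : seq (A * B)) : bool := `[< tens_eq s1 s2 >].

Fact tens_rel_equiv : equiv_class_of tens_rel.
Proof.
split.
- by move=> s; apply/asboolP/tens_refl.
- by move=> s1 s2; apply/asboolP/asboolP; apply: tens_sym.
- move=> s2 s1 s3 /asboolP h12 /asboolP h23; apply/asboolP.
  exact: tens_trans h12 h23.
Qed.

Canonical tens_equiv := EquivRelPack tens_rel_equiv.

Definition tensor : Type := {eq_quot tens_equiv}.
HB.instance Definition _ := Choice.on tensor.
HB.instance Definition _ := EqQuotient.on tensor.

Definition pure (a : A) (b : B) : tensor := \pi_tensor [:: (a, b)].

Lemma tensP s1 s2 : \pi_tensor s1 = \pi_tensor s2 <-> tens_eq s1 s2.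
Proof.
split=> [/eqmodP /asboolP //|h]; apply/eqmodP; exact/asboolP.
Qed.

Lemma tensW (P : tensor -> Prop) :
  (forall s, P (\pi_tensor s)) -> forall x, P x.
Proof. by move=> h x; rewrite -[x]reprK. Qed.

Lemma tens_reprK s : tens_eq (repr (\pi_tensor s)) s.
Proof. by apply/tensP; rewrite reprK. Qed.

Definition tens_add (x y : tensor) : tensor := \pi_tensor (repr x ++ repr y).
Definition tens_scaleseq (c : k) (s : seq (A * B)) : seq (A * B) :=
  [seq (c *: p.1, p.2) | p <- s].
Definition tens_scl (c : k) (x : tensor) : tensor :=
  \pi_tensor (tens_scaleseq c (repr x)).

Lemma pi_cat s1 s2 :
  \pi_tensor (s1 ++ s2) = tens_add (\pi_tensor s1) (\pi_tensor s2).
Proof. by apply/tensP/tens_cat; apply/tens_sym/tens_reprK. Qed.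

Lemma tens_scaleseq_eq c s1 s2 :
  tens_eq s1 s2 -> tens_eq (tens_scaleseq c s1) (tens_scaleseq c s2).
Proof.
rewrite /tens_scaleseq.
elim=> {s1 s2} /=.
- by move=> s; apply: tens_refl.
- by move=> s1 s2 _; apply: tens_sym.
- by move=> s1 s2 s3 _ h1 _ h2; apply: tens_trans h1 h2.
- by move=> s1 s2 s3 s4 _ h1 _ h2; rewrite !map_cat; apply: tens_cat.
- by move=> s1 s2; rewrite !map_cat; apply: tens_catC.
- by move=> a a' b; rewrite scalerDr; apply: tens_addl.
- by move=> a b b'; apply: tens_addr.
- by move=> d a b; rewrite scalerA mulrC -scalerA; apply: tens_scale.
- by move=> b; rewrite scaler0; apply: tens_zero.
Qed.

Lemma pi_scale c s :
  \pi_tensor (tens_scaleseq c s) = tens_scl c (\pi_tensor s).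
Proof. by apply/tensP/tens_scaleseq_eq/tens_sym/tens_reprK. Qed.

Fact tens_addA : associative tens_add.
Proof.
by elim/tensW=> s1; elim/tensW=> s2; elim/tensW=> s3; rewrite -!pi_cat catA.
Qed.

Fact tens_addC : commutative tens_add.
Proof.
by elim/tensW=> s1; elim/tensW=> s2; rewrite -!pi_cat; apply/tensP/tens_catC.
Qed.

Fact tens_add0 : left_id (\pi_tensor [::]) tens_add.
Proof. by elim/tensW=> s; rewrite -pi_cat. Qed.

Lemma tens_scaleseq0 s : tens_eq (tens_scaleseq 0 s) [::].
Proof.
elim: s => [|[a b] s IH] /=; first exact: tens_refl.
rewrite scale0r -cat1s -[X in tens_eq _ X]cat0s.
exact: tens_cat (tens_zero b) IH.
Qed.

Lemma tens_scaleseqD c d s :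
  tens_eq (tens_scaleseq (c + d) s) (tens_scaleseq c s ++ tens_scaleseq d s).
Proof.
apply/tensP; rewrite pi_cat.
elim: s => [|[a b] s IH] /=; first by rewrite tens_add0.
rewrite -cat1s pi_cat IH -[in RHS]cat1s -[(d *: a, b) :: _]cat1s !pi_cat.
have -> : \pi_tensor [:: ((c + d) *: a, b)] =
    tens_add (\pi_tensor [:: (c *: a, b)]) (\pi_tensor [:: (d *: a, b)]).
  by rewrite -pi_cat scalerDl; apply/tensP/tens_addl.
rewrite -!tens_addA; congr tens_add; rewrite !tens_addA; congr tens_add.
exact: tens_addC.
Qed.

Fact tens_addN : left_inverse (\pi_tensor [::]) (tens_scl (-1)) tens_add.
Proof.
elim/tensW=> s; rewrite -pi_scale -pi_cat; apply/tensP.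
have e1 : s = tens_scaleseq 1 s.
  by rewrite /tens_scaleseq -[LHS]map_id; apply: eq_map => -[a b] /=; rewrite scale1r.
rewrite {2}e1; apply: tens_trans (tens_sym (tens_scaleseqD _ _ _)) _.
by rewrite addNr; apply: tens_scaleseq0.
Qed.

HB.instance Definition _ :=
  GRing.isZmodule.Build tensor tens_addA tens_addC tens_add0 tens_addN.

Lemma piD s1 s2 :
  \pi_tensor (s1 ++ s2) = \pi_tensor s1 + \pi_tensor s2 :> tensor.
Proof. exact: pi_cat. Qed.

Fact tens_sclA a b x : tens_scl a (tens_scl b x) = tens_scl (a * b) x.
Proof.
elim/tensW: x => s; rewrite -!pi_scale /tens_scaleseq -map_comp.
by congr (\pi_tensor _); apply: eq_map => -[u v] /=; rewrite scalerA.
Qed.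

Fact tens_scl1 : left_id 1 tens_scl.
Proof.
elim/tensW=> s; rewrite -!pi_scale; congr (\pi_tensor _).
by rewrite /tens_scaleseq -[RHS]map_id; apply: eq_map => -[u v] /=; rewrite scale1r.
Qed.

Fact tens_sclDr : right_distributive tens_scl +%R.
Proof.
move=> c; elim/tensW=> s1; elim/tensW=> s2.
by rewrite -piD -!pi_scale -piD /tens_scaleseq map_cat.
Qed.

Fact tens_sclDl x : {morph tens_scl^~ x : a b / a + b}.
Proof.
move=> a b; elim/tensW: x => s; rewrite -!pi_scale -piD.
exact/tensP/tens_scaleseqD.
Qed.

HB.instance Definition _ :=
  GRing.Zmodule_isLmodule.Build k tensor tens_sclA tens_scl1 tens_sclDr
    tens_sclDl.

Lemma pureDl a a' b : pure (a + a') b = pure a b + pure a' b.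
Proof. by rewrite -piD; apply/tensP/tens_addl. Qed.

Lemma pureDr a b b' : pure a (b + b') = pure a b + pure a b'.
Proof. by rewrite -piD; apply/tensP/tens_addr. Qed.

Lemma pureZl c a b : pure (c *: a) b = c *: pure a b.
Proof. exact: (pi_scale c [:: (a, b)]). Qed.

Lemma pureZr c a b : pure a (c *: b) = c *: pure a b.
Proof. by rewrite -pureZl; apply/tensP/tens_sym/tens_scale. Qed.

Lemma pi_sum s : \pi_tensor s = \sum_(p <- s) pure p.1 p.2.
Proof.
elim: s => [|[a b] s IH]; first by rewrite big_nil.
by rewrite big_cons -cat1s piD IH.
Qed.

Lemma tens_sumE (x : tensor) : x = \sum_(p <- repr x) pure p.1 p.2.
Proof. by rewrite -pi_sum reprK. Qed.

Lemma tens_ind (P : tensor -> Prop) :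
  P 0 -> (forall a b x, P x -> P (pure a b + x)) -> forall x, P x.
Proof.
move=> P0 PD x; rewrite [x]tens_sumE.
by elim: (repr x) => [|p s IH]; rewrite ?big_nil // big_cons; apply: PD.
Qed.

Section Lift.
Variable W : lmodType k.

Record bilin (f : A -> B -> W) : Prop := Bilin {
  bilinDl : forall a a' b, f (a + a') b = f a b + f a' b;
  bilinDr : forall a b b', f a (b + b') = f a b + f a b';
  bilinZl : forall c a b, f (c *: a) b = c *: f a b;
  bilinZr : forall c a b, f a (c *: b) = c *: f a b
}.

(* The linear map A (x) B -> W induced by f; meaningful for f bilinear, in    *)
(* which case it does not depend on the representative (tlift_pi).            *)
Definition tlift (f : A -> B -> W) (x : tensor) : W :=
  \sum_(p <- repr x) f p.1 p.2.

Variable f : A -> B -> W.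
Hypothesis bf : bilin f.

Lemma tens_eq_sum s1 s2 : tens_eq s1 s2 ->
  \sum_(p <- s1) f p.1 p.2 = \sum_(p <- s2) f p.1 p.2.
Proof.
elim=> {s1 s2} //.
- by move=> s1 s2 s3 _ -> _ ->.
- by move=> s1 s2 s3 s4 _ h1 _ h2; rewrite !big_cat h1 h2.
- by move=> s1 s2; rewrite !big_cat /= addrC.
- by move=> a a' b; rewrite !big_cons !big_nil /= !addr0 (bilinDl bf).
- by move=> a b b'; rewrite !big_cons !big_nil /= !addr0 (bilinDr bf).
- by move=> c a b; rewrite !big_cons !big_nil /= (bilinZl bf) (bilinZr bf).
- move=> b; rewrite big_cons big_nil /= addr0.
  by rewrite -[0 : A](scale0r 0) (bilinZl bf) scale0r.
Qed.

Lemma tlift_pi s : tlift f (\pi_tensor s) = \sum_(p <- s) f p.1 p.2.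
Proof. exact/tens_eq_sum/tens_reprK. Qed.

Lemma tlift_pure a b : tlift f (pure a b) = f a b.
Proof. by rewrite tlift_pi big_seq1. Qed.

Lemma tliftD x y : tlift f (x + y) = tlift f x + tlift f y.
Proof. by elim/tensW: x => s; elim/tensW: y => s'; rewrite -piD !tlift_pi big_cat. Qed.

Lemma tliftZ c x : tlift f (c *: x) = c *: tlift f x.
Proof.
elim/tensW: x => s; rewrite -[c *: _]pi_scale !tlift_pi big_map scaler_sumr.
by apply: eq_bigr => p _; rewrite (bilinZl bf).
Qed.

Lemma tlift0 : tlift f 0 = 0.
Proof. by rewrite -(scale0r (0 : tensor)) tliftZ scale0r. Qed.

Lemma tlift_linear : linear (tlift f).
Proof. by move=> c x y; rewrite tliftD tliftZ. Qed.

End Lift.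

Lemma pure_bilin : bilin pure.
Proof. by split=> *; rewrite ?(pureDl, pureDr, pureZl, pureZr). Qed.

Lemma tens_eq_lin (W : lmodType k) (f g : tensor -> W) :
  linear f -> linear g -> (forall a b, f (pure a b) = g (pure a b)) -> f =1 g.
Proof.
move=> lf lg fg.
have lD (h : tensor -> W) : linear h -> forall x y, h (x + y) = h x + h y.
  by move=> lh x y; have := lh 1 x y; rewrite !scale1r.
have l0 (h : tensor -> W) : linear h -> h 0 = 0.
  by move=> lh; have /eqP := lD h lh 0 0; rewrite addr0 -subr_eq0 opprD addrA subrr add0r oppr_eq0 => /eqP.
elim/tens_ind => [|a b x IH]; first by rewrite !l0.
by rewrite !lD // IH fg.
Qed.

(* (a (x) b) (a' (x) b') = a a' (x) b b'                                       *)
Definition tens_mulr1 (a : A) (b : B) (y : tensor) : tensor :=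
  tlift (fun a' b' => pure (a * a') (b * b')) y.
Definition tens_mul (x y : tensor) : tensor :=
  tlift (fun a b => tens_mulr1 a b y) x.

Lemma tens_mul_bilin1 a b : bilin (fun a' b' => pure (a * a') (b * b')).
Proof.
split=> *; rewrite ?(mulrDr, pureDl, pureDr) //.
- by rewrite -uscalerAr pureZl.
- by rewrite -uscalerAr pureZr.
Qed.

Lemma tens_mulr1_pure a b a' b' :
  tens_mulr1 a b (pure a' b') = pure (a * a') (b * b').
Proof. exact: (tlift_pure (tens_mul_bilin1 a b)). Qed.

Lemma tens_mul_bilin2 y : bilin (fun a b => tens_mulr1 a b y).
Proof.
split.
- move=> a a' b; rewrite /tens_mulr1 /tlift -big_split.
  by apply: eq_bigr => p _; rewrite mulrDl pureDl.
- move=> a b b'; rewrite /tens_mulr1 /tlift -big_split.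
  by apply: eq_bigr => p _; rewrite mulrDl pureDr.
- move=> c a b; rewrite /tens_mulr1 /tlift scaler_sumr.
  by apply: eq_bigr => p _; rewrite -uscalerAl pureZl.
- move=> c a b; rewrite /tens_mulr1 /tlift scaler_sumr.
  by apply: eq_bigr => p _; rewrite -uscalerAl pureZr.
Qed.

Lemma tens_mul_pure a b a' b' :
  tens_mul (pure a b) (pure a' b') = pure (a * a') (b * b').
Proof. by rewrite /tens_mul (tlift_pure (tens_mul_bilin2 _)) tens_mulr1_pure. Qed.

Fact tens_mulDl : left_distributive tens_mul +%R.
Proof. by move=> x y z; rewrite /tens_mul (tliftD (tens_mul_bilin2 _)). Qed.

Fact tens_mulZl c x y : tens_mul (c *: x) y = c *: tens_mul x y.
Proof. by rewrite /tens_mul (tliftZ (tens_mul_bilin2 _)). Qed.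

Fact tens_mulDr : right_distributive tens_mul +%R.
Proof.
move=> x y z; rewrite /tens_mul /tlift -big_split; apply: eq_bigr => p _ /=.
exact: (tliftD (tens_mul_bilin1 _ _)).
Qed.

Fact tens_mulZr c x y : tens_mul x (c *: y) = c *: tens_mul x y.
Proof.
rewrite /tens_mul /tlift scaler_sumr; apply: eq_bigr => p _ /=.
exact: (tliftZ (tens_mul_bilin1 _ _)).
Qed.

Fact tens_mulA : associative tens_mul.
Proof.
move=> x y z; move: x.
apply: tens_eq_lin => [c u v|c u v|a b]; rewrite ?(tens_mulDl, tens_mulZl) //.
move: y; apply: tens_eq_lin => [c u v|c u v|a' b'];
  rewrite ?(tens_mulDl, tens_mulZl, tens_mulDr, tens_mulZr) //.
move: z; apply: tens_eq_lin => [c u v|c u v|a'' b''];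
  rewrite ?(tens_mulDl, tens_mulZl, tens_mulDr, tens_mulZr) //.
by rewrite !tens_mul_pure !mulrA.
Qed.

Fact tens_mul1l : left_id (pure 1 1) tens_mul.
Proof.
apply: tens_eq_lin => [c u v|c u v|a b];
  rewrite ?(tens_mulDr, tens_mulZr) //.
by rewrite tens_mul_pure !mul1r.
Qed.

Fact tens_mul1r : right_id (pure 1 1) tens_mul.
Proof.
apply: tens_eq_lin => [c u v|c u v|a b];
  rewrite ?(tens_mulDl, tens_mulZl) //.
by rewrite tens_mul_pure !mulr1.
Qed.

HB.instance Definition _ :=
  GRing.Zmodule_isPzRing.Build tensor tens_mulA tens_mul1l tens_mul1r
    tens_mulDl tens_mulDr.

HB.instance Definition _ :=
  isUnitalAlg.Build k tensor tens_mulA tens_mul1l tens_mul1r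
    tens_mulDl tens_mulDr tens_mulZl tens_mulZr.

Lemma pureM a b a' b' : pure a b * pure a' b' = pure (a * a') (b * b').
Proof. exact: tens_mul_pure. Qed.

(* The image in A (x) B of P (x) B, for P a subset (in practice a subspace)   *)
(* of A.                                                                      *)
Definition in_left_tensor (P : A -> Prop) (x : tensor) : Prop :=
  exists s : seq (A * B),
    (forall p, p \in s -> P p.1) /\ x = \sum_(p <- s) pure p.1 p.2.

End Tensor.

Arguments tensor {k} (A B)%_type_scope.
Notation "A ⊗ B" := (tensor A B) (at level 40, left associativity) : type_scope.
Notation "a ⊗ b" := (pure a b) (at level 40, left associativity) : ring_scope.

Section TensorMaps.
Variable k : fieldType.

Lemma linearPP (U V : lmodType k) (f : U -> V) : linear f ->
  (forall x y, f (x + y) = f x + f y) /\ (forall c x, f (c *: x) = c *: f x).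
Proof.
move=> lf; have fD x y : f (x + y) = f x + f y by rewrite -[x]scale1r lf !scale1r.
have f0 : f 0 = 0 by apply: (addrI (f 0)); rewrite -fD !addr0.
by split=> // c x; rewrite -[c *: x]addr0 lf f0 addr0.
Qed.

Definition tmap (A B A' B' : ualgType k) (f : A -> A') (g : B -> B') :
  A ⊗ B -> A' ⊗ B' := tlift (fun a b => f a ⊗ g b).

Definition tassoc (A B C : ualgType k) : (A ⊗ B) ⊗ C -> A ⊗ (B ⊗ C) :=
  tlift (fun x c => tlift (fun a b => a ⊗ (b ⊗ c)) x).

Definition tlunit (A : ualgType k) : k^o ⊗ A -> A :=
  tlift (fun (c : k^o) a => (c : k) *: a).

Definition trunit (A : ualgType k) : A ⊗ k^o -> A :=
  tlift (fun a (c : k^o) => (c : k) *: a).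

Lemma tmap_pure (A B A' B' : ualgType k) (f : A -> A') (g : B -> B') a b :
  linear f -> linear g -> tmap f g (a ⊗ b) = f a ⊗ g b.
Proof.
move=> lf lg; apply: tlift_pure.
have [fD fZ] := (linearPP lf).
have [gD gZ] := (linearPP lg).
by split=> *; rewrite ?(fD, gD, fZ, gZ) ?(pureDl, pureDr, pureZl, pureZr).
Qed.

Lemma tassoc_pure (A B C : ualgType k) (a : A) (b : B) (c : C) :
  tassoc ((a ⊗ b) ⊗ c) = a ⊗ (b ⊗ c).
Proof.
have bl (d : C) : bilin (fun (a : A) (b : B) => a ⊗ (b ⊗ d)).
  by split=> *; rewrite ?(pureDl, pureDr, pureZl, pureZr).
rewrite -[RHS](tlift_pure (bl c)); apply: (tlift_pure
  (f := fun x d => tlift (fun (a : A) (b : B) => a ⊗ (b ⊗ d)) x)).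
split=> [x y d|x d d'|z x d|z d x].
- exact: (tliftD (bl d)).
- rewrite /tlift -big_split; apply: eq_bigr => p _.
  by rewrite !pureDr.
- exact: (tliftZ (bl d)).
- rewrite /tlift scaler_sumr; apply: eq_bigr => p _.
  by rewrite !pureZr.
Qed.

Lemma tlunit_pure (A : ualgType k) (c : k) (a : A) :
  tlunit ((c : k^o) ⊗ a) = c *: a.
Proof.
apply: (tlift_pure (f := fun (c : k^o) a => (c : k) *: a)).
split=> *; rewrite ?(scalerDl, scalerDr) // ?scalerA //.
by rewrite mulrC.
Qed.

Lemma trunit_pure (A : ualgType k) (c : k) (a : A) :
  trunit (a ⊗ (c : k^o)) = c *: a.
Proof.
apply: (tlift_pure (f := fun a (c : k^o) => (c : k) *: a)).
split=> *; rewrite ?(scalerDl, scalerDr) // ?scalerA //.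
by rewrite mulrC.
Qed.

End TensorMaps.

(* -------------------------------------------------------------------------- *)
(* Free algebras: the monoid algebra of the free monoid on X.                 *)

Section FreeAlg.
Variables (k : fieldType) (X : choiceType).

Definition free_alg : Type := {malg k[{fmonom X}]}.
HB.instance Definition _ := GRing.Lalgebra.on free_alg.

Fact free_mulZl (c : k) (x y : free_alg) : (c *: x) * y = c *: (x * y).
Proof. by rewrite scalerAl. Qed.

Fact free_mulZr (c : k) (x y : free_alg) : x * (c *: y) = c *: (x * y).
Proof.
rewrite -!mul_malgC !mulrA; congr (_ * _).
rewrite malgM_def malgM_def fgmulUg fgmulgU; apply: eq_bigr => w _.
by rewrite mulrC mulm1 mul1m.
Qed.

HB.instance Definition _ :=
  isUnitalAlg.Build k free_alg (@mulrA free_alg) (@mul1r free_alg)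
    (@mulr1 free_alg) (@mulrDl free_alg) (@mulrDr free_alg)
    free_mulZl free_mulZr.

Definition free_gen (x : X) : free_alg := << fmu x >>.

End FreeAlg.

(* -------------------------------------------------------------------------- *)
(* The quotient of an algebra by the two-sided ideal generated by a subset S. *)

Section QuotAlg.
Variables (k : fieldType) (B : ualgType k) (S : B -> Prop).

Inductive in_ideal : B -> Prop :=
| in_ideal_gen x : S x -> in_ideal x
| in_ideal_zero : in_ideal 0
| in_ideal_add x y : in_ideal x -> in_ideal y -> in_ideal (x + y)
| in_ideal_mull a x : in_ideal x -> in_ideal (a * x)
| in_ideal_mulr a x : in_ideal x -> in_ideal (x * a).

Definition quot_rel (x y : B) : bool := `[< in_ideal (x - y) >].

Lemma in_idealZ c x : in_ideal x -> in_ideal (c *: x).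
Proof.
by move=> Ix; rewrite -[x]mul1r uscalerAl; apply: in_ideal_mull.
Qed.

Lemma in_idealN x : in_ideal x -> in_ideal (- x).
Proof. by rewrite -scaleN1r; apply: in_idealZ. Qed.

Fact quot_rel_equiv : equiv_class_of quot_rel.
Proof.
split.
- by move=> x; apply/asboolP; rewrite subrr; apply: in_ideal_zero.
- by move=> x y; apply/asboolP/asboolP => /in_idealN; rewrite opprB.
- move=> y x z /asboolP h1 /asboolP h2; apply/asboolP.
  by rewrite -(subrKA y); apply: in_ideal_add.
Qed.

Canonical quot_equiv := EquivRelPack quot_rel_equiv.

Definition quot_alg : Type := {eq_quot quot_equiv}.
HB.instance Definition _ := Choice.on quot_alg.
HB.instance Definition _ := EqQuotient.on quot_alg.

Definition quot_proj (x : B) : quot_alg := \pi_quot_alg x.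

Lemma quot_projP x y : quot_proj x = quot_proj y <-> in_ideal (x - y).
Proof.
split=> [/eqmodP /asboolP //|h]; apply/eqmodP; exact/asboolP.
Qed.

Lemma quot_reprK x : in_ideal (repr (quot_proj x) - x).
Proof. by apply/quot_projP; rewrite /quot_proj reprK. Qed.

Definition quot_add (x y : quot_alg) := quot_proj (repr x + repr y).
Definition quot_opp (x : quot_alg) := quot_proj (- repr x).
Definition quot_mul (x y : quot_alg) := quot_proj (repr x * repr y).
Definition quot_scale (c : k) (x : quot_alg) := quot_proj (c *: repr x).

Lemma quot_addE x y : quot_add (quot_proj x) (quot_proj y) = quot_proj (x + y).
Proof.
apply/quot_projP; rewrite opprD addrACA.
by apply: in_ideal_add; apply: quot_reprK.
Qed.

Lemma quot_oppE x : quot_opp (quot_proj x) = quot_proj (- x).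
Proof. by apply/quot_projP; rewrite -opprD; apply/in_idealN/quot_reprK. Qed.

Lemma quot_scaleE c x : quot_scale c (quot_proj x) = quot_proj (c *: x).
Proof. by apply/quot_projP; rewrite -scalerBr; apply/in_idealZ/quot_reprK. Qed.

Lemma quot_mulE x y : quot_mul (quot_proj x) (quot_proj y) = quot_proj (x * y).
Proof.
apply/quot_projP; set x' := repr _; set y' := repr _.
have -> : x' * y' - x * y = (x' - x) * y' + x * (y' - y).
  by rewrite mulrBl mulrBr addrA subrK.
apply: in_ideal_add.
  by apply: in_ideal_mulr; apply: quot_reprK.
by apply: in_ideal_mull; apply: quot_reprK.
Qed.

Lemma quot_ind (P : quot_alg -> Prop) : (forall x, P (quot_proj x)) -> forall x, P x.
Proof. by move=> h x; rewrite -[x]reprK. Qed.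

Fact quot_addA : associative quot_add.
Proof. by do 3![elim/quot_ind => ?]; rewrite !quot_addE addrA. Qed.
Fact quot_addC : commutative quot_add.
Proof. by do 2![elim/quot_ind => ?]; rewrite !quot_addE addrC. Qed.
Fact quot_add0 : left_id (quot_proj 0) quot_add.
Proof. by elim/quot_ind => ?; rewrite !quot_addE add0r. Qed.
Fact quot_addN : left_inverse (quot_proj 0) quot_opp quot_add.
Proof. by elim/quot_ind => ?; rewrite quot_oppE !quot_addE addNr. Qed.

HB.instance Definition _ :=
  GRing.isZmodule.Build quot_alg quot_addA quot_addC quot_add0 quot_addN.

Lemma quot_projD x y : quot_proj (x + y) = quot_proj x + quot_proj y.
Proof. by rewrite -quot_addE. Qed.

Fact quot_mulA : associative quot_mul.
Proof. by do 3![elim/quot_ind => ?]; rewrite !quot_mulE mulrA. Qed.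
Fact quot_mul1l : left_id (quot_proj 1) quot_mul.
Proof. by elim/quot_ind => ?; rewrite !quot_mulE mul1r. Qed.
Fact quot_mul1r : right_id (quot_proj 1) quot_mul.
Proof. by elim/quot_ind => ?; rewrite !quot_mulE mulr1. Qed.
Fact quot_mulDl : left_distributive quot_mul +%R.
Proof.
do 3![elim/quot_ind => ?].
by rewrite -quot_projD !quot_mulE -quot_projD mulrDl.
Qed.
Fact quot_mulDr : right_distributive quot_mul +%R.
Proof.
do 3![elim/quot_ind => ?].
by rewrite -quot_projD !quot_mulE -quot_projD mulrDr.
Qed.

HB.instance Definition _ :=
  GRing.Zmodule_isPzRing.Build quot_alg quot_mulA quot_mul1l quot_mul1r
    quot_mulDl quot_mulDr.

Fact quot_scaleA a b x : quot_scale a (quot_scale b x) = quot_scale (a * b) x.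
Proof. by elim/quot_ind: x => ?; rewrite !quot_scaleE scalerA. Qed.
Fact quot_scale1 : left_id 1 quot_scale.
Proof. by elim/quot_ind => ?; rewrite !quot_scaleE scale1r. Qed.
Fact quot_scaleDr : right_distributive quot_scale +%R.
Proof.
move=> c; do 2![elim/quot_ind => ?].
by rewrite -quot_projD !quot_scaleE -quot_projD scalerDr.
Qed.
Fact quot_scaleDl x : {morph quot_scale^~ x : a b / a + b}.
Proof.
by move=> a b; elim/quot_ind: x => ?; rewrite !quot_scaleE -quot_projD scalerDl.
Qed.

HB.instance Definition _ :=
  GRing.Zmodule_isLmodule.Build k quot_alg quot_scaleA quot_scale1 quot_scaleDr
    quot_scaleDl.

Fact quot_mulZl (c : k) (x y : quot_alg) : quot_mul (c *: x) y = c *: quot_mul x y.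
Proof.
elim/quot_ind: x => x; elim/quot_ind: y => y.
rewrite -[c *: quot_proj x]/(quot_scale c _) -[RHS]/(quot_scale c _).
by rewrite quot_mulE !quot_scaleE quot_mulE uscalerAl.
Qed.
Fact quot_mulZr (c : k) (x y : quot_alg) : quot_mul x (c *: y) = c *: quot_mul x y.
Proof.
elim/quot_ind: x => x; elim/quot_ind: y => y.
rewrite -[c *: quot_proj y]/(quot_scale c _) -[RHS]/(quot_scale c _).
by rewrite quot_mulE !quot_scaleE quot_mulE uscalerAr.
Qed.

HB.instance Definition _ :=
  isUnitalAlg.Build k quot_alg quot_mulA quot_mul1l quot_mul1r
    quot_mulDl quot_mulDr quot_mulZl quot_mulZr.

Lemma quot_proj_algmap : unital_algmap quot_proj.
Proof.
split=> // [c x y|x y]; first by rewrite quot_projD -quot_scaleE.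
by rewrite -quot_mulE.
Qed.

End QuotAlg.

Arguments quot_alg {k} B S.
Arguments quot_proj {k B} S x.

(* -------------------------------------------------------------------------- *)
(* [k^o] is the base field as an algebra over itself.                         *)

Section Bialgebras.
Variable k : fieldType.

Definition is_bialgebra (M : ualgType k) (Delta : M -> M ⊗ M) (eps : M -> k^o)
  : Prop :=
  [/\ unital_algmap Delta,
      unital_algmap eps,
      forall x, tassoc (tmap Delta id (Delta x)) = tmap id Delta (Delta x),
      forall x, tlunit (tmap eps id (Delta x)) = x
    & forall x, trunit (tmap id eps (Delta x)) = x].

Definition is_coaction (A M : ualgType k) (Delta : M -> M ⊗ M) (eps : M -> k^o)
    (beta : A -> A ⊗ M) : Prop :=
  (forall a, tassoc (tmap beta id (beta a)) = tmap id Delta (beta a)) /\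
  (forall a, trunit (tmap id eps (beta a)) = a).

Definition is_bialgebra_map (M N : ualgType k)
    (DeltaM : M -> M ⊗ M) (epsM : M -> k^o)
    (DeltaN : N -> N ⊗ N) (epsN : N -> k^o) (f : M -> N) : Prop :=
  [/\ unital_algmap f,
      forall x, DeltaN (f x) = tmap f f (DeltaM x)
    & forall x, epsN (f x) = epsM x].

End Bialgebras.

(* -------------------------------------------------------------------------- *)

Section Comeasurings.
Variables (k : fieldType) (A : ualgType k).

Definition comeasuring (B : ualgType k) (beta : A -> A ⊗ B) : Prop :=
  unital_algmap beta.

Definition any_comeasuring (B : ualgType k) (beta : A -> A ⊗ B) : Prop := True.

Definition respects_splitting (P : A -> Prop) (B : ualgType k)
    (beta : A -> A ⊗ B) : Prop :=
  forall a, P a -> in_left_tensor P (beta a).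

(* (M, beta) is initial among the comeasurings with property Q.               *)
Definition initial_comeasuring
    (Q : forall B : ualgType k, (A -> A ⊗ B) -> Prop)
    (M : ualgType k) (beta : A -> A ⊗ M) : Prop :=
  [/\ comeasuring beta, Q M beta
    & forall (B : ualgType k) (gamma : A -> A ⊗ B),
        comeasuring gamma -> Q B gamma ->
        exists2 f : M -> B,
          unital_algmap f /\ (forall a, gamma a = tmap id f (beta a))
        & forall g : M -> B,
            unital_algmap g -> (forall a, gamma a = tmap id g (beta a)) ->
            g =1 f].

(* Such a bialgebra structure is unique: by initiality, Delta is the only     *)
(* algebra map with (beta (x) id) beta = (id (x) Delta) beta, and eps the     *)
(* only one with (id (x) eps) beta = id.                                      *)
Definition comeasuring_bialgebra
    (Q : forall B : ualgType k, (A -> A ⊗ B) -> Prop)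
    (M : ualgType k) (beta : A -> A ⊗ M)
    (Delta : M -> M ⊗ M) (eps : M -> k^o) : Prop :=
  [/\ initial_comeasuring Q beta, is_bialgebra Delta eps
    & is_coaction Delta eps beta].

End Comeasurings.

Arguments any_comeasuring {k} A B beta.
Arguments respects_splitting {k A} P B beta.

(* [sconst e i j l] is the coefficient of e_l in the product e_i e_j.         *)
Definition sconst (k : fieldType) (A : falgType k) (m : nat) (e : m.-tuple A)
    (i j l : 'I_m) : k :=
  coord e l (tnth e i * tnth e j).

(* -------------------------------------------------------------------------- *)
(* M(A) and M_0(A) by generators and relations, from structure constants c    *)
(* indexed by 0, ..., n. The indices 1, ..., n of the generators are          *)
(* represented by 'I_n, embedded into 'I_n.+1 by [lift ord0]. A relation      *)
(* u = v is imposed by factoring out u - v, and [t i j] stands for t^i_j.     *)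

Section Presentations.
Variables (k : fieldType) (n : nat) (c : 'I_n.+1 -> 'I_n.+1 -> 'I_n.+1 -> k).

Local Notation up := (lift ord0).

Section Relators.
Variables (B : ualgType k) (b : 'I_n -> B) (t : 'I_n -> 'I_n -> B).

Definition comeas_relator1 (i j l : 'I_n) : B :=
  \sum_a c (up i) (up j) (up a) *: t l a
  - (\sum_a \sum_d c (up a) (up d) (up l) *: (t a i * t d j)
     + b i * t l j + t l i * b j).

Definition comeas_relator2 (i j : 'I_n) : B :=
  (c (up i) (up j) ord0 *: (1 : B) + \sum_a c (up i) (up j) (up a) *: b a)
  - (\sum_a \sum_d c (up a) (up d) ord0 *: (t a i * t d j) + b i * b j).

Definition restr_relator1 (i j l : 'I_n) : B :=
  \sum_a c (up i) (up j) (up a) *: t l a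
  - \sum_a \sum_d c (up a) (up d) (up l) *: (t a i * t d j).

Definition restr_relator2 (i j : 'I_n) : B :=
  c (up i) (up j) ord0 *: (1 : B)
  - \sum_a \sum_d c (up a) (up d) ord0 *: (t a i * t d j).

End Relators.

Let F := free_alg k ('I_n + 'I_n * 'I_n)%type.
Let Fb (i : 'I_n) : F := free_gen k (inl i).
Let Ft (i j : 'I_n) : F := free_gen k (inr (i, j)).

Definition comeas_relators (x : F) : Prop :=
  (exists i j l, x = comeas_relator1 Fb Ft i j l) \/
  (exists i j, x = comeas_relator2 Fb Ft i j).

Definition comeas_alg : ualgType k := quot_alg F comeas_relators.
Definition comeas_b (i : 'I_n) : comeas_alg := quot_proj comeas_relators (Fb i).
Definition comeas_t (i j : 'I_n) : comeas_alg :=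
  quot_proj comeas_relators (Ft i j).

Let F0 := free_alg k ('I_n * 'I_n)%type.
Let F0t (i j : 'I_n) : F0 := free_gen k (i, j).

Definition restr_relators (x : F0) : Prop :=
  (exists i j l, x = restr_relator1 F0t i j l) \/
  (exists i j, x = restr_relator2 F0t i j).

Definition restr_alg : ualgType k := quot_alg F0 restr_relators.
Definition restr_t (i j : 'I_n) : restr_alg :=
  quot_proj restr_relators (F0t i j).

(* The elements factored out of M(A) by setting b_i = 0 for all i.            *)
Definition is_comeas_b (x : comeas_alg) : Prop := exists i, x = comeas_b i.

End Presentations.

(* Main.v *)
Require Import Defs.
From HB Require Import structures.
From mathcomp Require Import all_boot all_order all_algebra all_field.
From mathcomp Require Import finmap monalg.

(* A linear map beta : A -> A (x) B is the same as a matrix u over B, via     *)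
(* beta(e_j) = sum_i e_i (x) u_ij, and it is an algebra map iff u_i0 =        *)
(* delta_i0 and sum_a c_ij^a u_la = sum_(a,d) c_ad^l u_ai u_dj for all i, j,  *)
(* l. The cases i = 0 or j = 0 are automatic; writing b_j = u_0j and t = the  *)
(* remaining block, the other cases are exactly the defining relations of     *)
(* M(A), and beta respects the splitting iff b = 0, which gives those of      *)
(* M_0(A). So both presentations are initial. Composing two coactions         *)
(* multiplies their matrices, and the identity matrix corresponds to          *)
(* a |-> a (x) 1; initiality applied to these yields Delta and eps, and the   *)
(* bialgebra axioms reduce to associativity and unit laws of matrices.        *)

Set Implicit Arguments.
Unset Strict Implicit.
Unset Printing Implicit Defensive.

Import GRing.Theory.
Local Open Scope ring_scope.

(** * Linear and algebra maps *)

(** Algebra maps out of M(A) and M_0(A) are choices of generators satisfying the relations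
    ([comeas_alg_lift], [restr_alg_lift], with uniqueness by [comeas_alg_ext], [restr_alg_ext]), so
    initiality follows once comeasurings are written in coordinates. Every element of [A ⊗ B]
    expands along the basis ([tensor_expand]), hence a linear map from A to [A ⊗ B] is [coact E u]
    for exactly one matrix u ([coact_coords], [coact_inj]). Being a unital algebra map translates
    into [comat] ([coact_algmapP]), and this into the relators ([comat_blockP]); respecting the
    splitting translates into the vanishing of the b_j ([respects_splittingP]).

    The coalgebra structure needs no computation with relations: the product of two comeasuring
    matrices belongs to a composite of algebra maps ([comat_mul]), so the universal property
    supplies [Delta], and the identity matrix supplies [eps]. The axioms equate algebra maps, so
    they are checked on matrix entries ([matrix_bialgebra], [matrix_coaction]).

    Finally, M(A) modulo the b_i and M_0(A) both classify comeasuring matrices with b = 0, hence are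
    isomorphic ([quot_comeas_restr]). The isomorphism matches the universal matrices, so it respects
    comultiplication, counit and coaction. *)

Section LinearMaps.
Variables (k : fieldType) (U V : lmodType k) (f : U -> V).
Hypothesis lf : linear f.

Lemma linD x y : f (x + y) = f x + f y. Proof. by case: (linearPP lf). Qed.
Lemma linZ c x : f (c *: x) = c *: f x. Proof. by case: (linearPP lf). Qed.
Lemma lin0 : f 0 = 0. Proof. by rewrite -(scale0r 0) linZ scale0r. Qed.
Lemma linB x y : f (x - y) = f x - f y.
Proof. by rewrite -scaleN1r linD linZ scaleN1r. Qed.
Lemma lin_sum I (r : seq I) (P : pred I) (F : I -> U) :
  f (\sum_(i <- r | P i) F i) = \sum_(i <- r | P i) f (F i).
Proof. exact: (big_morph f linD lin0). Qed.

End LinearMaps.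

Lemma linear_comp (k : fieldType) (U V W : lmodType k) (f : V -> W)
  (g : U -> V) : linear f -> linear g -> linear (fun x => f (g x)).
Proof. by move=> lf lg c x y; rewrite lg lf. Qed.

Lemma mull_linear (k : fieldType) (B : ualgType k) (a : B) :
  linear (fun x : B => a * x).
Proof. by move=> c x y; rewrite mulrDr -uscalerAr. Qed.

Lemma mulr_linear (k : fieldType) (B : ualgType k) (a : B) :
  linear (fun x : B => x * a).
Proof. by move=> c x y; rewrite mulrDl -uscalerAl. Qed.

Section AlgMaps.
Variables (k : fieldType) (B C D : ualgType k).

Lemma algmap_lin (f : B -> C) : unital_algmap f -> linear f.
Proof. by case. Qed.

Lemma algmapM (f : B -> C) : unital_algmap f -> {morph f : x y / x * y}.
Proof. by case. Qed.

Lemma algmap1 (f : B -> C) : unital_algmap f -> f 1 = 1.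
Proof. by case. Qed.

Lemma algmap_id : unital_algmap (@id B).
Proof. by split. Qed.

Lemma algmap_comp (f : C -> D) (g : B -> C) :
  unital_algmap f -> unital_algmap g -> unital_algmap (fun x => f (g x)).
Proof.
move=> [lf fM f1] [lg gM g1]; split; first exact: linear_comp.
- by move=> x y; rewrite gM fM.
- by rewrite g1 f1.
Qed.

Lemma algmap_eq (f g : B -> C) : f =1 g -> unital_algmap f -> unital_algmap g.
Proof.
by move=> fg [lf fM f1]; split=> [c x y|x y|]; rewrite -!fg ?lf ?fM.
Qed.

End AlgMaps.

(** * Sums in tensor products and algebra maps out of them *)

Section TensorSums.
Variables (k : fieldType) (A B : ualgType k).

Lemma pure_suml I (r : seq I) (P : pred I) (F : I -> A) (b : B) :
  (\sum_(i <- r | P i) F i) ⊗ b = \sum_(i <- r | P i) F i ⊗ b.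
Proof.
apply: (lin_sum (f := fun a => a ⊗ b)) => c x y.
by rewrite pureDl pureZl.
Qed.

Lemma pure_sumr I (r : seq I) (P : pred I) (a : A) (F : I -> B) :
  a ⊗ (\sum_(i <- r | P i) F i) = \sum_(i <- r | P i) a ⊗ F i.
Proof.
apply: (lin_sum (f := fun b => a ⊗ b)) => c x y.
by rewrite pureDr pureZr.
Qed.

Lemma pure0l (b : B) : (0 : A) ⊗ b = 0.
Proof. by rewrite -(scale0r 0) pureZl scale0r. Qed.

Lemma pure0r (a : A) : a ⊗ (0 : B) = 0.
Proof. by rewrite -(scale0r 0) pureZr scale0r. Qed.

(** Both sides of multiplicativity are linear in each argument and pure tensors span, so only pure
    tensors need checking. *)
Lemma tensor_algmap (C : ualgType k) (f : A ⊗ B -> C) : linear f ->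
  (forall a b a' b', f ((a ⊗ b) * (a' ⊗ b')) = f (a ⊗ b) * f (a' ⊗ b')) ->
  f (1 ⊗ 1) = 1 -> unital_algmap f.
Proof.
move=> lf fM f1; split=> // x y; move: x.
apply: tens_eq_lin => [c u v|c u v|a b].
- by rewrite mulrDl -uscalerAl lf.
- by rewrite lf mulrDl -uscalerAl.
move: y; apply: tens_eq_lin => [c u v|c u v|a' b'] //.
- by rewrite mulrDr -uscalerAr lf.
- by rewrite lf mulrDr -uscalerAr.
Qed.

End TensorSums.

Section TensorMapsLinear.
Variable k : fieldType.

Lemma tmap_linear (A B A' B' : ualgType k) (f : A -> A') (g : B -> B') :
  linear f -> linear g -> linear (tmap f g).
Proof.
move=> lf lg; apply: tlift_linear; split=> *.
- by rewrite (linD lf) pureDl.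
- by rewrite (linD lg) pureDr.
- by rewrite (linZ lf) pureZl.
- by rewrite (linZ lg) pureZr.
Qed.

Lemma tmap_algmap (A B A' B' : ualgType k) (f : A -> A') (g : B -> B') :
  unital_algmap f -> unital_algmap g -> unital_algmap (tmap f g).
Proof.
move=> [lf fM f1] [lg gM g1]; apply: tensor_algmap => [|a b a' b'|].
- exact: tmap_linear.
- by rewrite pureM !tmap_pure // pureM fM gM.
- by rewrite tmap_pure // f1 g1.
Qed.

Lemma tassoc_linear (A B C : ualgType k) : linear (@tassoc k A B C).
Proof.
have bl (d : C) : bilin (fun (a : A) (b : B) => a ⊗ (b ⊗ d)).
  by split=> *; rewrite ?(pureDl, pureDr, pureZl, pureZr).
apply: tlift_linear; split=> [x y d|x d d'|z x d|z x d].
- exact: (tliftD (bl d)).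
- rewrite /tlift -big_split; apply: eq_bigr => p _.
  by rewrite !pureDr.
- exact: (tliftZ (bl d)).
- rewrite /tlift scaler_sumr; apply: eq_bigr => p _.
  by rewrite !pureZr.
Qed.

Lemma tassoc_algmap (A B C : ualgType k) : unital_algmap (@tassoc k A B C).
Proof.
have lt := @tassoc_linear A B C.
apply: tensor_algmap => // [x c y c'|]; last exact: tassoc_pure.
(* [tensor_algmap] opens only the outer tensor; [x] and [y] are still arbitrary in [A ⊗ B] and are
   reduced to pure tensors in turn. *)
rewrite pureM; move: x.
have lp (z : C) : linear (fun w : A ⊗ B => w ⊗ z).
  by move=> s u v; rewrite pureDl pureZl.
apply: tens_eq_lin => [s u v|s u v|a b].
- by rewrite mulrDl -uscalerAl lp lt.
- by rewrite lp lt mulrDl -uscalerAl.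
move: y; apply: tens_eq_lin => [s u v|s u v|a' b'].
- by rewrite mulrDr -uscalerAr lp lt.
- by rewrite lp lt mulrDr -uscalerAr.
by rewrite pureM !tassoc_pure !pureM.
Qed.

Lemma tlunit_algmap (A : ualgType k) : unital_algmap (@tlunit k A).
Proof.
apply: tensor_algmap => [|c a c' a'|]; last by rewrite tlunit_pure scale1r.
  apply: tlift_linear; split=> *; rewrite ?(scalerDl, scalerDr) // ?scalerA //.
  by rewrite mulrC.
by rewrite pureM !tlunit_pure -uscalerAl -uscalerAr scalerA.
Qed.

Lemma trunit_algmap (A : ualgType k) : unital_algmap (@trunit k A).
Proof.
apply: tensor_algmap => [|a c a' c'|]; last by rewrite trunit_pure scale1r.
  apply: tlift_linear; split=> *; rewrite ?(scalerDl, scalerDr) // ?scalerA //.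
  by rewrite mulrC.
by rewrite pureM !trunit_pure -uscalerAl -uscalerAr scalerA.
Qed.

End TensorMapsLinear.

(** * Universal properties of the presentations *)

Section FreeLift.
Variables (k : fieldType) (X : choiceType) (C : ualgType k).

Definition free_lift (h : X -> C) (g : free_alg k X) : C :=
  \sum_(w <- msupp g) g@_w *: \prod_(x <- w : seq X) h x.

Variable h : X -> C.

(** Supports change under linear combination; summing over a common larger set makes linearity of
    the evaluation a termwise matter. *)
Lemma free_lift_wide (d : {fset {fmonom X}}) (g : free_alg k X) :
  (msupp g `<=` d)%fset ->
  free_lift h g = \sum_(w <- d) g@_w *: \prod_(x <- w : seq X) h x.
Proof.
move=> le; rewrite /free_lift (big_fset_incl _ le) // => w _ /mcoeff_outdom ->.
by rewrite scale0r.
Qed.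

Lemma free_lift_linear : linear (free_lift h).
Proof.
move=> c x y; pose d := (msupp x `|` msupp y)%fset.
have le : (msupp (c *: x + y) `<=` d)%fset.
  by apply: (fsubset_trans (msuppD_le _ _)); rewrite fsetSU // msuppZ_le.
rewrite (free_lift_wide le).
rewrite (free_lift_wide (fsubsetUl _ _ : msupp x `<=` d)%fset).
rewrite (free_lift_wide (fsubsetUr _ _ : msupp y `<=` d)%fset).
rewrite scaler_sumr -big_split; apply: eq_bigr => w _ /=.
by rewrite mcoeffD mcoeffZ scalerDl scalerA.
Qed.

Lemma free_lift_word (w : {fmonom X}) :
  free_lift h (<< w >> : free_alg k X) = \prod_(x <- w : seq X) h x.
Proof. by rewrite /free_lift msuppU1 big_seq_fset1 mcoeffUU scale1r. Qed.

Lemma free_lift_gen x : free_lift h (free_gen k x) = h x.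
Proof. by rewrite free_lift_word fmuE big_seq1. Qed.

Lemma free_wordE (g : free_alg k X) :
  g = \sum_(w <- msupp g) g@_w *: (<< w >> : free_alg k X).
Proof.
have wZ (a : k) w : << a *g w >> = a *: << w >> :> {malg k[{fmonom X}]}.
  by apply/malgP => w'; rewrite mcoeffZ !mcoeffU mulr_natr.
by rewrite {1}[g]monalgE; apply: eq_bigr => w _; apply: wZ.
Qed.

Lemma free_linear_ext (W : lmodType k) (f g : free_alg k X -> W) :
  linear f -> linear g -> (forall w, f << w >> = g << w >>) -> f =1 g.
Proof.
move=> lf lg fg x; rewrite [x]free_wordE (lin_sum lf) (lin_sum lg).
by apply: eq_bigr => w _; rewrite (linZ lf) (linZ lg) fg.
Qed.

Lemma free_wordM (v w : {fmonom X}) :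
  (<< v >> : free_alg k X) * (<< w >> : free_alg k X) = << mmul v w >>.
Proof. by rewrite malgM_def fgmulUU mulr1. Qed.

Lemma free_lift_algmap : unital_algmap (free_lift h).
Proof.
have lf := free_lift_linear; split=> // [x y|]; last first.
  by rewrite (_ : 1 = << mone >>) // free_lift_word fm1 big_nil.
move: x; apply: free_linear_ext => [||v].
- exact: (linear_comp lf (mulr_linear y)).
- exact: (linear_comp (mulr_linear (free_lift h y)) lf).
move: y; apply: free_linear_ext => [||w].
- exact: (linear_comp lf (mull_linear (<< v >> : free_alg k X))).
- exact: (linear_comp (mull_linear (free_lift h << v >>)) lf).
by rewrite free_wordM !free_lift_word fmM big_cat.
Qed.

Lemma free_algmap_ext (f g : free_alg k X -> C) :
  unital_algmap f -> unital_algmap g ->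
  (forall x, f (free_gen k x) = g (free_gen k x)) -> f =1 g.
Proof.
move=> [lf fM f1] [lg gM g1] fg; apply: free_linear_ext => // w.
case: w => s; elim: s => [|i s IH].
  have -> : << FMonom [::] >> = 1 :> free_alg k X.
    by congr (<< _ >>); apply/esym/fmoneE.
  by rewrite f1 g1.
have -> : << FMonom (i :: s) >> = free_gen k i * << FMonom s >>.
  rewrite free_wordM; congr (<< _ >>); apply/eqP; rewrite fmP.
  by rewrite fmM fmuE.
by rewrite fM gM fg IH.
Qed.

End FreeLift.

Section QuotLift.
Variables (k : fieldType) (B C : ualgType k) (S : B -> Prop).

(** Evaluates [f] on a chosen representative; for an algebra map vanishing on [S] the choice is
    immaterial, by [quot_lift_proj]. *)
Definition quot_lift (f : B -> C) (x : quot_alg B S) : C := f (repr x).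

Lemma quot_lift_proj (f : B -> C) : unital_algmap f ->
  (forall x, S x -> f x = 0) -> forall x, quot_lift f (quot_proj S x) = f x.
Proof.
move=> [lf fM f1] fS x; apply/eqP; rewrite -subr_eq0 -(linB lf); apply/eqP.
elim: (quot_reprK S x) => {x} [x /fS //||x y _ + _|a x _|a x _].
- exact: lin0.
- by rewrite (linD lf) => -> ->; rewrite addr0.
- by rewrite fM => ->; rewrite mulr0.
- by rewrite fM => ->; rewrite mul0r.
Qed.

Lemma quot_lift_algmap (f : B -> C) : unital_algmap f ->
  (forall x, S x -> f x = 0) -> unital_algmap (quot_lift f).
Proof.
move=> af fS; have fE := quot_lift_proj af fS.
have [lp pM p1] := quot_proj_algmap S.
split=> [c|| ]; last by rewrite -p1 fE (algmap1 af).
- elim/quot_ind=> x; elim/quot_ind=> y.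
  by rewrite -lp !fE (algmap_lin af).
- elim/quot_ind=> x; elim/quot_ind=> y.
  by rewrite -pM !fE (algmapM af).
Qed.

Lemma quot_proj_gen x : S x -> quot_proj S x = 0.
Proof.
move=> Sx; have [lp _ _] := quot_proj_algmap S.
rewrite -(lin0 lp); apply/quot_projP; rewrite subr0.
exact: in_ideal_gen.
Qed.

End QuotLift.

Section Relators.
Variables (k : fieldType) (n : nat) (c : 'I_n.+1 -> 'I_n.+1 -> 'I_n.+1 -> k).
Variables (B C : ualgType k).

Lemma comeas_relator1_morph (f : B -> C) b t i j l : unital_algmap f ->
  f (comeas_relator1 c b t i j l) =
  comeas_relator1 c (fun i => f (b i)) (fun i j => f (t i j)) i j l.
Proof.
move=> [lf fM f1]; rewrite /comeas_relator1 (linB lf) !(linD lf) !fM.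
rewrite !(lin_sum lf); congr (_ - (_ + _ + _)).
  by apply: eq_bigr => a _; rewrite (linZ lf).
apply: eq_bigr => a _; rewrite (lin_sum lf); apply: eq_bigr => d _.
by rewrite (linZ lf) fM.
Qed.

Lemma comeas_relator2_morph (f : B -> C) b t i j : unital_algmap f ->
  f (comeas_relator2 c b t i j) =
  comeas_relator2 c (fun i => f (b i)) (fun i j => f (t i j)) i j.
Proof.
move=> [lf fM f1]; rewrite /comeas_relator2 (linB lf) !(linD lf) !fM (linZ lf) f1.
rewrite !(lin_sum lf); congr (_ + _ - (_ + _)).
  by apply: eq_bigr => a _; rewrite (linZ lf).
apply: eq_bigr => a _; rewrite (lin_sum lf); apply: eq_bigr => d _.
by rewrite (linZ lf) fM.
Qed.

Lemma restr_relator1E (t : 'I_n -> 'I_n -> B) i j l :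
  restr_relator1 c t i j l = comeas_relator1 c (fun=> 0) t i j l.
Proof. by rewrite /comeas_relator1 mul0r mulr0 !addr0. Qed.

Lemma restr_relator2E (t : 'I_n -> 'I_n -> B) i j :
  restr_relator2 c t i j = comeas_relator2 c (fun=> 0) t i j.
Proof.
rewrite /comeas_relator2 mulr0 addr0; congr (_ - _).
by rewrite big1 ?addr0 // => a _; rewrite scaler0.
Qed.

End Relators.

Section Presentations.
Variables (k : fieldType) (n : nat) (c : 'I_n.+1 -> 'I_n.+1 -> 'I_n.+1 -> k).

(** Serves both presentations: by [restr_relator1E] and [restr_relator2E] the relations of M_0(A)
    are the case b = 0. *)
Definition comeas_relations (B : ualgType k) (b : 'I_n -> B)
    (t : 'I_n -> 'I_n -> B) : Prop :=
  (forall i j l, comeas_relator1 c b t i j l = 0) /\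
  (forall i j, comeas_relator2 c b t i j = 0).

Lemma comeas_relations_alg : comeas_relations (comeas_b c) (comeas_t c).
Proof.
have ap := quot_proj_algmap (@comeas_relators k n c).
split=> [i j l|i j].
- rewrite -(comeas_relator1_morph _ _ _ _ _ _ ap) quot_proj_gen //.
  by left; exists i, j, l.
- rewrite -(comeas_relator2_morph _ _ _ _ _ ap) quot_proj_gen //.
  by right; exists i, j.
Qed.

Lemma restr_relations_alg :
  comeas_relations (fun=> 0 : restr_alg c) (restr_t c).
Proof.
have ap := quot_proj_algmap (@restr_relators k n c).
have p0 := lin0 (algmap_lin ap).
pose F0 := free_alg k ('I_n * 'I_n)%type.
split=> [i j l|i j].
- rewrite -[LHS](_ : quot_proj _ (restr_relator1 c
    (fun i j => free_gen k (i, j) : F0) i j l) = _).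
    by rewrite quot_proj_gen //; left; exists i, j, l.
  by rewrite restr_relator1E (comeas_relator1_morph _ _ _ _ _ _ ap) p0.
- rewrite -[LHS](_ : quot_proj _ (restr_relator2 c
    (fun i j => free_gen k (i, j) : F0) i j) = _).
    by rewrite quot_proj_gen //; right; exists i, j.
  by rewrite restr_relator2E (comeas_relator2_morph _ _ _ _ _ ap) p0.
Qed.

Lemma comeas_alg_lift (B : ualgType k) (b : 'I_n -> B) (t : 'I_n -> 'I_n -> B) :
  comeas_relations b t ->
  exists f : comeas_alg c -> B,
    [/\ unital_algmap f, forall i, f (comeas_b c i) = b i
      & forall i j, f (comeas_t c i j) = t i j].
Proof.
move=> [r1 r2].
pose h (x : 'I_n + 'I_n * 'I_n) := 
  match x with inl i => b i | inr p => t p.1 p.2 end.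
have ah := free_lift_algmap h.
have hS x : comeas_relators c x -> free_lift h x = 0.
  case=> [[i [j [l ->]]]|[i [j ->]]].
  - rewrite comeas_relator1_morph // -[RHS](r1 i j l) /comeas_relator1.
    by congr (_ - (_ + _ + _)); rewrite ?free_lift_gen //;
      do ?[apply: eq_bigr => ? _]; rewrite !free_lift_gen.
  - rewrite comeas_relator2_morph // -[RHS](r2 i j) /comeas_relator2.
    by congr (_ + _ - (_ + _)); rewrite ?free_lift_gen //;
      do ?[apply: eq_bigr => ? _]; rewrite !free_lift_gen.
exists (quot_lift (free_lift h)); split; first exact: quot_lift_algmap.
- by move=> i; rewrite quot_lift_proj // free_lift_gen.
- by move=> i j; rewrite quot_lift_proj // free_lift_gen.
Qed.

Lemma restr_alg_lift (B : ualgType k) (t : 'I_n -> 'I_n -> B) :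
  comeas_relations (fun=> 0) t ->
  exists f : restr_alg c -> B,
    unital_algmap f /\ forall i j, f (restr_t c i j) = t i j.
Proof.
move=> [r1 r2].
pose h (x : 'I_n * 'I_n) := t x.1 x.2.
have ah := free_lift_algmap h; have h0 := lin0 (algmap_lin ah).
have hS x : restr_relators c x -> free_lift h x = 0.
  case=> [[i [j [l ->]]]|[i [j ->]]].
  - rewrite restr_relator1E comeas_relator1_morph // h0.
    rewrite -[RHS](r1 i j l) /comeas_relator1.
    by congr (_ - (_ + _ + _)); rewrite ?free_lift_gen //;
      do ?[apply: eq_bigr => ? _]; rewrite !free_lift_gen.
  - rewrite restr_relator2E comeas_relator2_morph // h0.
    rewrite -[RHS](r2 i j) /comeas_relator2.
    by congr (_ + _ - (_ + _)); do ?[apply: eq_bigr => ? _];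
      rewrite !free_lift_gen.
exists (quot_lift (free_lift h)); split; first exact: quot_lift_algmap.
by move=> i j; rewrite quot_lift_proj // free_lift_gen.
Qed.

Lemma comeas_alg_ext (B : ualgType k) (f g : comeas_alg c -> B) :
  unital_algmap f -> unital_algmap g ->
  (forall i, f (comeas_b c i) = g (comeas_b c i)) ->
  (forall i j, f (comeas_t c i j) = g (comeas_t c i j)) -> f =1 g.
Proof.
move=> af ag eb et; elim/quot_ind.
have ap := quot_proj_algmap (@comeas_relators k n c).
by apply: free_algmap_ext => [||[i|[i j]]]; first exact: (algmap_comp af ap);
  first exact: (algmap_comp ag ap); [exact: eb | exact: et].
Qed.

Lemma restr_alg_ext (B : ualgType k) (f g : restr_alg c -> B) :
  unital_algmap f -> unital_algmap g ->
  (forall i j, f (restr_t c i j) = g (restr_t c i j)) -> f =1 g.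
Proof.
move=> af ag et; elim/quot_ind.
have ap := quot_proj_algmap (@restr_relators k n c).
by apply: free_algmap_ext => [||[i j]]; first exact: (algmap_comp af ap);
  first exact: (algmap_comp ag ap); exact: et.
Qed.

End Presentations.

(** * Comeasurings as matrices *)

Section ComeasuringMatrices.
Variables (k : fieldType) (A : falgType k) (n : nat) (E : n.+1.-tuple A).
Hypothesis basisE : basis_of fullv E.
Hypothesis E0 : tnth E ord0 = 1.

Local Notation c := (sconst E).

Lemma coord_tnth i j : coord E i (tnth E j) = (i == j)%:R.
Proof.
by rewrite (tnth_nth 0) coord_free ?(basis_free basisE) // eq_sym.
Qed.

Lemma coord_expand (a : A) : a = \sum_j coord E j a *: tnth E j.
Proof.
rewrite {1}(coord_basis basisE (memvf a)).
by apply: eq_bigr => j _; rewrite (tnth_nth 0).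
Qed.

Lemma sconst_mul i j : tnth E i * tnth E j = \sum_a c i j a *: tnth E a.
Proof. exact: coord_expand. Qed.

Lemma sconst0l j l : c ord0 j l = (l == j)%:R.
Proof. by rewrite /sconst E0 mul1r coord_tnth. Qed.

Lemma sconst0r i l : c i ord0 l = (l == i)%:R.
Proof. by rewrite /sconst E0 mulr1 coord_tnth. Qed.

Definition comat (B : ualgType k) (u : 'I_n.+1 -> 'I_n.+1 -> B) : Prop :=
  (forall i, u i ord0 = (i == ord0)%:R) /\
  (forall i j l, \sum_a c i j a *: u l a
     = \sum_a \sum_d c a d l *: (u a i * u d j)).

Definition coact (B : ualgType k) (u : 'I_n.+1 -> 'I_n.+1 -> B) (a : A) : A ⊗ B :=
  \sum_j coord E j a *: \sum_i tnth E i ⊗ u i j.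

(** The i-th coordinate tensored with the identity of [B]: it reads off the coefficient of e_i in
    [A ⊗ B]. *)
Definition tcoord (B : ualgType k) (i : 'I_n.+1) : A ⊗ B -> B :=
  tlift (fun a b => coord E i a *: b).

Section OneAlgebra.
Variable B : ualgType k.
Implicit Types u v : 'I_n.+1 -> 'I_n.+1 -> B.

Lemma tcoord_bilin i : bilin (fun (a : A) (b : B) => coord E i a *: b).
Proof.
split=> [a a' b|a b b'|s a b|s a b].
- by rewrite linearD scalerDl.
- by rewrite scalerDr.
- by rewrite linearZ scalerA.
- by rewrite !scalerA mulrC.
Qed.

Lemma tcoord_linear i : linear (@tcoord B i).
Proof. exact/tlift_linear/tcoord_bilin. Qed.

Lemma tcoord_pure i a b : tcoord i (a ⊗ b : A ⊗ B) = coord E i a *: b.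
Proof. exact: (tlift_pure (tcoord_bilin i)). Qed.

Lemma tensor_expand (x : A ⊗ B) : x = \sum_i tnth E i ⊗ tcoord i x.
Proof.
move: x; apply: (tens_eq_lin (f := id)) => // [s x y|a b].
  rewrite scaler_sumr -big_split; apply: eq_bigr => i _ /=.
  by rewrite tcoord_linear pureDr pureZr.
rewrite {1}[a]coord_expand pure_suml; apply: eq_bigr => i _.
by rewrite tcoord_pure pureZl pureZr.
Qed.

Lemma coact_linear u : linear (coact u).
Proof.
move=> s x y; rewrite scaler_sumr -big_split; apply: eq_bigr => j _ /=.
by rewrite linearD linearZ scalerDl scalerA.
Qed.

Lemma coact_basis u j : coact u (tnth E j) = \sum_i tnth E i ⊗ u i j.
Proof.
rewrite /coact (bigD1 j) //= coord_tnth eqxx scale1r.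
rewrite [X in _ + X]big1 ?addr0 // => i ij.
by rewrite coord_tnth (negPf ij) scale0r.
Qed.

Lemma tcoord_coact u i j : tcoord i (coact u (tnth E j)) = u i j.
Proof.
rewrite coact_basis (lin_sum (tcoord_linear i)) (bigD1 i) //= big1.
  by rewrite tcoord_pure coord_tnth eqxx scale1r addr0.
by move=> l li; rewrite tcoord_pure coord_tnth eq_sym (negPf li) scale0r.
Qed.

Lemma coact_coords (beta : A -> A ⊗ B) : linear beta ->
  beta =1 coact (fun i j => tcoord i (beta (tnth E j))).
Proof.
move=> lb a; rewrite {1}[a]coord_expand (lin_sum lb); apply: eq_bigr => j _.
by rewrite (linZ lb); congr (_ *: _); apply: tensor_expand.
Qed.

Lemma comat_ext u v : u =2 v -> comat u -> comat v.
Proof.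
move=> uv [u0 uM]; split=> [i|i j l]; first by rewrite -uv.
transitivity (\sum_a c i j a *: u l a); first by apply: eq_bigr => a _; rewrite uv.
rewrite uM; apply: eq_bigr => a _; apply: eq_bigr => d _.
by rewrite !uv.
Qed.

Lemma coact_ext u v : u =2 v -> coact u =1 coact v.
Proof.
move=> uv a; apply: eq_bigr => j _; congr (_ *: _).
by apply: eq_bigr => i _; rewrite uv.
Qed.

Lemma coact_inj u v : coact u =1 coact v -> u =2 v.
Proof. by move=> uv i j; rewrite -!tcoord_coact uv. Qed.

Lemma coact_mul u i j :
  coact u (tnth E i) * coact u (tnth E j) =
  \sum_l tnth E l ⊗ \sum_a \sum_d c a d l *: (u a i * u d j).
Proof.
rewrite !coact_basis mulr_suml.
transitivity (\sum_a \sum_d \sum_l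
    tnth E l ⊗ (c a d l *: (u a i * u d j))).
  apply: eq_bigr => a _; rewrite mulr_sumr; apply: eq_bigr => d _.
  rewrite pureM -[X in X ⊗ _](esym (sconst_mul a d)) pure_suml.
  by apply: eq_bigr => l _; rewrite pureZl pureZr.
under eq_bigr => a _ do rewrite exchange_big /=.
rewrite exchange_big /=; apply: eq_bigr => l _.
by rewrite pure_sumr; apply: eq_bigr => a _; rewrite pure_sumr.
Qed.

Lemma coact_of_mul u i j :
  coact u (tnth E i * tnth E j) = \sum_l tnth E l ⊗ \sum_a c i j a *: u l a.
Proof.
rewrite sconst_mul (lin_sum (coact_linear u)).
transitivity (\sum_a \sum_l tnth E l ⊗ (c i j a *: u l a)).
  apply: eq_bigr => a _; rewrite (linZ (coact_linear u)) coact_basis scaler_sumr.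
  by apply: eq_bigr => l _; rewrite pureZr.
by rewrite exchange_big /=; apply: eq_bigr => l _; rewrite pure_sumr.
Qed.

(** The image of e_i e_j and the product of the images are both expanded along the basis
    ([coact_of_mul], [coact_mul]). [tcoord] compares their coefficients, and bilinearity passes from
    the basis to all of [A]. *)
Lemma coact_algmapP u : unital_algmap (coact u) <-> comat u.
Proof.
have lu := coact_linear u; split=> [[_ uM u1]|[u0 uM]].
  split=> [i|i j l].
    rewrite -tcoord_coact E0 [coact u _]u1.
    have -> : tcoord i (1 : A ⊗ B) = coord E i (tnth E ord0) *: (1 : B).
      by rewrite E0; apply: tcoord_pure.
    rewrite coord_tnth; by case: (i == _); rewrite ?scale1r ?scale0r.
  have lt := tcoord_linear l.
  have E_tc (x : 'I_n.+1 -> B) : tcoord l (\sum_i tnth E i ⊗ x i) = x l.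
    rewrite (lin_sum lt) (bigD1 l) //= big1.
      by rewrite tcoord_pure coord_tnth eqxx scale1r addr0.
    by move=> p pl; rewrite tcoord_pure coord_tnth eq_sym (negPf pl) scale0r.
  have := congr1 (tcoord l) (uM (tnth E i) (tnth E j)).
  rewrite coact_mul.
  by rewrite [X in coact u X](_ : _ = tnth E i * tnth E j) // coact_of_mul !E_tc.
split=> // [x y|].
  change (coact u (x * y : A) = coact u x * coact u y).
  rewrite [x]coord_expand [y]coord_expand mulr_suml !(lin_sum lu) mulr_suml.
  apply: eq_bigr => i _; rewrite mulr_sumr (lin_sum lu) mulr_sumr.
  apply: eq_bigr => j _.
  rewrite -uscalerAl -uscalerAr !(linZ lu) -uscalerAl -uscalerAr; congr (_ *: (_ *: _)).
  rewrite [X in coact u X](_ : _ = tnth E i * tnth E j) //.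
  rewrite coact_mul coact_of_mul; apply: eq_bigr => l _.
  by rewrite uM.
change (coact u (1 : A) = 1).
rewrite -E0 coact_basis big_ord_recl big1 => [|i _]; last by rewrite u0 pure0r.
by rewrite u0 E0 addr0.
Qed.

End OneAlgebra.

Lemma tmap_coact (B C : ualgType k) (f : B -> C) u a : linear f ->
  tmap id f (coact u a) = coact (fun i j => f (u i j)) a.
Proof.
move=> lf; have lt : linear (tmap (@id A) f) by apply: tmap_linear.
rewrite (lin_sum lt); apply: eq_bigr => j _; rewrite (linZ lt) (lin_sum lt).
by congr (_ *: _); apply: eq_bigr => i _; rewrite tmap_pure.
Qed.

(** Applying [f] to the entries amounts to composing [coact u] with the algebra map [tmap id f]. *)
Lemma comat_morph (B C : ualgType k) (f : B -> C) u : unital_algmap f ->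
  comat u -> comat (fun i j => f (u i j)).
Proof.
move=> af /coact_algmapP au; apply/coact_algmapP.
apply: (algmap_eq (f := fun a => tmap id f (coact u a))).
  by move=> a; rewrite tmap_coact //; apply: algmap_lin.
by apply: algmap_comp => //; apply: tmap_algmap.
Qed.

Lemma coact_coact (B C : ualgType k) (u : 'I_n.+1 -> 'I_n.+1 -> B)
    (v : 'I_n.+1 -> 'I_n.+1 -> C) a :
  tassoc (tmap (coact u) id (coact v a)) =
  coact (fun i j => \sum_l u i l ⊗ v l j) a.
Proof.
have la := @tassoc_linear k A B C.
have lt : linear (tmap (coact u) (@id C)).
  by apply: tmap_linear => //; apply: coact_linear.
rewrite (lin_sum lt) (lin_sum la); apply: eq_bigr => j _.
rewrite (linZ lt) (linZ la) (lin_sum lt) (lin_sum la); congr (_ *: _).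
transitivity (\sum_l \sum_i tnth E i ⊗ (u i l ⊗ v l j)).
  apply: eq_bigr => l _; rewrite tmap_pure //; last exact: coact_linear.
  rewrite coact_basis pure_suml (lin_sum la).
  by apply: eq_bigr => i _; rewrite tassoc_pure.
by rewrite exchange_big /=; apply: eq_bigr => i _; rewrite pure_sumr.
Qed.

(** By [coact_coact] the product matrix belongs to the composite of two coactions followed by
    reassociation. All these maps are algebra maps, so the quadratic relations over [B ⊗ C] come for
    free. *)
Lemma comat_mul (B C : ualgType k) (u : 'I_n.+1 -> 'I_n.+1 -> B)
    (v : 'I_n.+1 -> 'I_n.+1 -> C) :
  comat u -> comat v -> comat (fun i j => \sum_l u i l ⊗ v l j).
Proof.
move=> /coact_algmapP au /coact_algmapP av; apply/coact_algmapP.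
apply: algmap_eq (coact_coact u v) _.
apply: (algmap_comp (@tassoc_algmap _ _ _ _)).
by apply: algmap_comp => //; apply: tmap_algmap.
Qed.

Lemma coact_id a : coact (fun i j => (i == j)%:R : k^o) a = a ⊗ 1.
Proof.
rewrite {2}[a]coord_expand pure_suml; apply: eq_bigr => j _.
rewrite pureZl (bigD1 j) //= big1 ?addr0 ?eqxx // => i ij.
by rewrite (negPf ij) pure0r.
Qed.

Lemma comat_id : comat (fun i j => (i == j)%:R : k^o).
Proof.
apply/coact_algmapP; apply: algmap_eq (fun a => esym (coact_id a)) _.
by split=> [s x y|x y|]; rewrite ?pureM ?mulr1 // pureDl pureZl.
Qed.

(** * Bialgebra and coaction axioms from a generating matrix *)

Section MatrixBialgebra.
Variables (M : ualgType k) (u : 'I_n.+1 -> 'I_n.+1 -> M).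
Variables (Delta : M -> M ⊗ M) (eps : M -> k^o).
Hypothesis u_ext : forall (B : ualgType k) (f g : M -> B),
  unital_algmap f -> unital_algmap g ->
  (forall i j, f (u i j) = g (u i j)) -> f =1 g.
Hypotheses (aD : unital_algmap Delta) (aeps : unital_algmap eps).
Hypothesis Delta_u : forall i j, Delta (u i j) = \sum_l u i l ⊗ u l j.
Hypothesis eps_u : forall i j, eps (u i j) = (i == j)%:R.

(** By [u_ext] each axiom need only hold on the entries of [u], where it is associativity or a unit
    law of matrix multiplication. *)
Lemma matrix_bialgebra : is_bialgebra Delta eps.
Proof.
have lD := algmap_lin aD; have leps := algmap_lin aeps.
have aid := @algmap_id k M.
split=> //; apply: u_ext => //.
- apply: (algmap_comp (@tassoc_algmap _ _ _ _)).
  by apply: algmap_comp => //; apply: tmap_algmap.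
- by apply: algmap_comp => //; apply: tmap_algmap.
- move=> i j; have lt1 : linear (tmap Delta (@id M)) by apply: tmap_linear.
  have lt2 : linear (tmap (@id M) Delta) by apply: tmap_linear.
  have la := @tassoc_linear k M M M.
  rewrite Delta_u (lin_sum lt1) (lin_sum la) (lin_sum lt2).
  transitivity (\sum_l \sum_p u i p ⊗ (u p l ⊗ u l j)).
    apply: eq_bigr => l _; rewrite tmap_pure // Delta_u pure_suml (lin_sum la).
    by apply: eq_bigr => p _; rewrite tassoc_pure.
  rewrite exchange_big; apply: eq_bigr => p _.
  by rewrite tmap_pure // Delta_u pure_sumr.
- apply: (algmap_comp (@tlunit_algmap _ _)).
  by apply: algmap_comp => //; apply: tmap_algmap.
- move=> i j; have lt : linear (tmap eps (@id M)) by apply: tmap_linear.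
  have ll := algmap_lin (@tlunit_algmap k M).
  rewrite Delta_u (lin_sum lt) (lin_sum ll) (bigD1 i) //= big1 => [|l li].
    by rewrite tmap_pure // eps_u eqxx tlunit_pure scale1r addr0.
  by rewrite tmap_pure // eps_u eq_sym (negPf li) tlunit_pure scale0r.
- apply: (algmap_comp (@trunit_algmap _ _)).
  by apply: algmap_comp => //; apply: tmap_algmap.
- move=> i j; have lt : linear (tmap (@id M) eps) by apply: tmap_linear.
  have lr := algmap_lin (@trunit_algmap k M).
  rewrite Delta_u (lin_sum lt) (lin_sum lr) (bigD1 j) //= big1 => [|l lj].
    by rewrite tmap_pure // eps_u eqxx trunit_pure scale1r addr0.
  by rewrite tmap_pure // eps_u (negPf lj) trunit_pure scale0r.
Qed.

Lemma matrix_coaction : is_coaction Delta eps (coact u).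
Proof.
have lD := algmap_lin aD; have leps := algmap_lin aeps.
split=> a.
  by rewrite coact_coact tmap_coact //; apply: coact_ext => i j; rewrite Delta_u.
rewrite tmap_coact // (coact_ext eps_u) coact_id.
by rewrite [1]/(1 : k) trunit_pure scale1r.
Qed.

End MatrixBialgebra.

(** [P] is the kernel of coordinate 0, so a tensor coming from [P] has no e_0-coefficient; on the
    basis vectors of [P] these coefficients are the entries of row 0. *)
Lemma respects_splittingP (P : {vspace A}) (B : ualgType k)
    (u : 'I_n.+1 -> 'I_n.+1 -> B) :
  (forall a, (a \in P) = (coord E ord0 a == 0)) ->
  respects_splitting (fun a => a \in P) B (coact u) <->
  (forall j, u ord0 (lift ord0 j) = 0).
Proof.
move=> PE; split=> [resp j|u0 a].
  have /resp [s [sP sE]] : tnth E (lift ord0 j) \in P by rewrite PE coord_tnth.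
  rewrite -tcoord_coact sE (lin_sum (tcoord_linear ord0)) big_seq big1 // => p /sP.
  by rewrite PE tcoord_pure => /eqP->; rewrite scale0r.
rewrite PE => /eqP a0.
(* The witness groups [coact u a] by rows and leaves out row 0: there the term j = 0 dies by [a0],
   the others by [u0]. *)
exists [seq (tnth E (lift ord0 i), \sum_j coord E j a *: u (lift ord0 i) j)
       | i <- enum 'I_n]; split=> [p /mapP[i _ ->]|].
  by rewrite PE coord_tnth.
rewrite big_map big_enum /= /coact.
transitivity (\sum_i tnth E i ⊗ \sum_j coord E j a *: u i j).
  under [RHS]eq_bigr => i _ do rewrite pure_sumr.
  rewrite exchange_big; apply: eq_bigr => j _; rewrite scaler_sumr.
  by apply: eq_bigr => i _; rewrite pureZr.
rewrite big_ord_recl big_ord_recl a0 scale0r add0r big1 ?pure0r ?add0r // => j _.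
by rewrite u0 scaler0.
Qed.

End ComeasuringMatrices.

(** * Block form of a comeasuring matrix *)

(* The matrix with columns (1, 0) and (b_j, t^._j). *)
Definition block_matrix (k : fieldType) (n : nat) (B : ualgType k)
    (b : 'I_n -> B) (t : 'I_n -> 'I_n -> B) (i j : 'I_n.+1) : B :=
  if unlift ord0 j is Some j' then
    if unlift ord0 i is Some i' then t i' j' else b j'
  else (i == ord0)%:R.

Section BlockMatrix.
Variables (k : fieldType) (n : nat) (B : ualgType k).
Variables (b : 'I_n -> B) (t : 'I_n -> 'I_n -> B).
Local Notation u := (block_matrix b t).
Local Notation up := (lift ord0).

Lemma block_matrix00 : u ord0 ord0 = 1.
Proof. by rewrite /block_matrix unlift_none. Qed.

Lemma block_matrixS0 i : u (up i) ord0 = 0.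
Proof. by rewrite /block_matrix unlift_none. Qed.

Lemma block_matrix0S j : u ord0 (up j) = b j.
Proof. by rewrite /block_matrix liftK unlift_none. Qed.

Lemma block_matrixSS i j : u (up i) (up j) = t i j.
Proof. by rewrite /block_matrix !liftK. Qed.

Definition block_matrixE :=
  (block_matrix00, block_matrixS0, block_matrix0S, block_matrixSS).

Lemma block_matrix_morph (C : ualgType k) (f : B -> C) i j : unital_algmap f ->
  f (u i j) = block_matrix (fun i => f (b i)) (fun i j => f (t i j)) i j.
Proof.
move=> [lf _ f1]; rewrite /block_matrix.
case: unliftP => [j' _|_]; first by case: unliftP.
by case: (i == ord0) => //; apply: lin0.
Qed.

End BlockMatrix.

Lemma ord_lift0_ind n (P : 'I_n.+1 -> Prop) :
  P ord0 -> (forall i, P (lift ord0 i)) -> forall i, P i.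
Proof. by move=> P0 PS i; case: (unliftP ord0 i) => [j|] ->. Qed.

Lemma block_matrix_ext (k : fieldType) n (B : ualgType k) (b b' : 'I_n -> B)
    (t t' : 'I_n -> 'I_n -> B) :
  b =1 b' -> t =2 t' -> block_matrix b t =2 block_matrix b' t'.
Proof.
move=> bb tt; elim/ord_lift0_ind=> [|i]; elim/ord_lift0_ind=> [|j];
  by rewrite !block_matrixE.
Qed.

Section Comeasurings.
Variables (k : fieldType) (A : falgType k) (n : nat) (E : n.+1.-tuple A).
Hypothesis basisE : basis_of fullv E.
Hypothesis E0 : tnth E ord0 = 1.

Local Notation c := (sconst E).
Local Notation up := (lift ord0).

Lemma comat_block (B : ualgType k) (u : 'I_n.+1 -> 'I_n.+1 -> B) : comat E u ->
  u =2 block_matrix (fun j => u ord0 (up j)) (fun i j => u (up i) (up j)).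
Proof.
move=> [u0 _]; elim/ord_lift0_ind=> [|i]; elim/ord_lift0_ind=> [|j];
  by rewrite block_matrixE ?u0.
Qed.

Section BlockRelations.
Variables (B : ualgType k) (b : 'I_n -> B) (t : 'I_n -> 'I_n -> B).
Local Notation u := (block_matrix b t).

(** Since e_0 = 1, the relations with i = 0 or j = 0 hold for any block matrix. The others give
    [comeas_relator2] for l = 0 and [comeas_relator1] for l > 0. *)
Lemma comat_blockP : comat E u <-> comeas_relations c b t.
Proof.
have u0 i : u i ord0 = (i == ord0)%:R.
  by elim/ord_lift0_ind: i => [|i]; rewrite block_matrixE.
have delta (x : 'I_n.+1 -> B) j : \sum_a (a == j)%:R *: x a = x j.
  rewrite (bigD1 j) //= big1 ?eqxx ?scale1r ?addr0 // => a /negPf->.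
  by rewrite scale0r.
have delta' (x : 'I_n.+1 -> B) j : \sum_a (j == a)%:R *: x a = x j.
  by rewrite -[RHS]delta; apply: eq_bigr => a _; rewrite eq_sym.
pose rel i j l := \sum_a c i j a *: u l a
  = \sum_a \sum_d c a d l *: (u a i * u d j).
have rel0l j l : rel ord0 j l.
  rewrite /rel; under eq_bigr => a _ do rewrite sconst0l //.
  rewrite delta big_ord_recl [X in _ + X]big1 => [|a _]; last first.
    by rewrite big1 // => d _; rewrite u0 mul0r scaler0.
  rewrite addr0; under eq_bigr => d _ do rewrite sconst0l // u0 mul1r.
  by rewrite delta'.
have rel0r i l : rel i ord0 l.
  rewrite /rel; under eq_bigr => a _ do rewrite sconst0r //.
  rewrite delta exchange_big /= big_ord_recl [X in _ + X]big1 => [|a _]; last first.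
    by rewrite big1 // => d _; rewrite u0 mulr0 scaler0.
  rewrite addr0; under eq_bigr => d _ do rewrite sconst0r // u0 mulr1.
  by rewrite delta'.
(* Split off a = 0 and d = 0. The row a = 0 contributes the term with left factor b_i, the column d
   = 0 the term with right factor b_j. For l = 0 both contain the summand b_i b_j of a = d = 0,
   hence the correction. *)
have quad l i j : \sum_a \sum_d c a d l *: (u a (up i) * u d (up j)) =
    \sum_a \sum_d c (up a) (up d) l *: (t a i * t d j)
    + b i * u l (up j) + u l (up i) * b j
    - (l == ord0)%:R *: (b i * b j).
  rewrite big_ord_recl.
  under eq_bigr => d _ do rewrite sconst0l // block_matrix0S.
  rewrite (delta' (fun d => b i * u d (up j))).
  under eq_bigr => a _ do
    rewrite big_ord_recl sconst0r // block_matrix0S block_matrixSS.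
  rewrite big_split /=.
  under [X in _ + (_ + X)]eq_bigr => a _ do
    under eq_bigr => d _ do rewrite block_matrixSS.
  have <- : (l == ord0)%:R *: (b i * b j)
      + \sum_a (l == up a)%:R *: (t a i * b j) = u l (up i) * b j.
    rewrite -(delta' (fun a => u a (up i) * b j)) big_ord_recl block_matrix0S.
    by congr (_ + _); apply: eq_bigr => a _; rewrite block_matrixSS.
  rewrite [X in _ + X - _]addrC !addrA addrK.
  by rewrite [LHS]addrC [LHS]addrA.
have relE1 i j l : rel (up i) (up j) (up l) <-> comeas_relator1 c b t i j l = 0.
  rewrite /rel quad scale0r subr0 !block_matrixSS big_ord_recl.
  rewrite block_matrixS0 scaler0 add0r.
  under eq_bigr => a _ do rewrite block_matrixSS.
  rewrite /comeas_relator1; split=> [->|/eqP]; first by rewrite subrr.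
  by rewrite subr_eq0 => /eqP.
have relE2 i j : rel (up i) (up j) ord0 <-> comeas_relator2 c b t i j = 0.
  rewrite /rel quad scale1r !block_matrix0S addrK big_ord_recl block_matrix00.
  under eq_bigr => a _ do rewrite block_matrix0S.
  rewrite /comeas_relator2; split=> [->|/eqP]; first by rewrite subrr.
  by rewrite subr_eq0 => /eqP.
split=> [[_ r]|[r1 r2]].
  by split=> [i j l|i j]; [apply/relE1/r | apply/relE2/r].
split=> //; elim/ord_lift0_ind=> [|i]; first exact: rel0l.
elim/ord_lift0_ind=> [|j]; first exact: rel0r.
by elim/ord_lift0_ind=> [|l]; [apply/relE2 | apply/relE1].
Qed.

End BlockRelations.

(* Abstracts the common part of M(A), where Q and R hold everywhere, and of   *)
(* M_0(A), where R says that the entries b_j of the matrix vanish.            *)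
Section Initial.
Variable Q : forall B : ualgType k, (A -> A ⊗ B) -> Prop.
Variable R : forall B : ualgType k, ('I_n.+1 -> 'I_n.+1 -> B) -> Prop.
Hypothesis QR : forall (B : ualgType k) (beta : A -> A ⊗ B)
  (u : 'I_n.+1 -> 'I_n.+1 -> B), beta =1 coact E u -> Q beta <-> R u.
Variables (M : ualgType k) (u : 'I_n.+1 -> 'I_n.+1 -> M).
Hypotheses (cu : comat E u) (Ru : R u).
Hypothesis R_mul : R (fun i j => \sum_l u i l ⊗ u l j).
Hypothesis R_id : R (fun i j => (i == j)%:R : k^o).
Hypothesis u_lift : forall (B : ualgType k) (v : 'I_n.+1 -> 'I_n.+1 -> B),
  comat E v -> R v ->
  exists f : M -> B, unital_algmap f /\ forall i j, f (u i j) = v i j.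
Hypothesis u_ext : forall (B : ualgType k) (f g : M -> B),
  unital_algmap f -> unital_algmap g ->
  (forall i j, f (u i j) = g (u i j)) -> f =1 g.

(** Any comeasuring is [coact E v] for its coordinate matrix [v], and an algebra map [f] carries
    [coact E u] to it exactly when it sends the entries of [u] to those of [v] ([tmap_coact],
    [coact_inj]). Existence and uniqueness of [f] are then [u_lift] and [u_ext]. *)
Lemma initial_matrix : initial_comeasuring Q (coact E u).
Proof.
split=> [||B gamma ag Qg]; first exact/coact_algmapP.
  exact: (QR (frefl (coact E u))).2.
have lg := algmap_lin ag; have gE := coact_coords basisE lg.
set v := (X in coact E X) in gE.
have cv : comat E v by apply/coact_algmapP => //; apply: algmap_eq gE ag.
have Rv : R v := (QR gE).1 Qg.
have [f [af fu]] := u_lift cv Rv.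
exists f.
  split=> // a; rewrite gE tmap_coact //; last exact: algmap_lin.
  by apply: coact_ext => i j; rewrite fu.
move=> g ag' gg; apply: u_ext => // i j; rewrite fu.
apply: (coact_inj basisE (u := fun i j => g (u i j))) => a.
by rewrite -tmap_coact -?gg ?gE //; apply: algmap_lin.
Qed.

(** [Delta] and [eps] classify the product of [u] with itself and the identity matrix; [R_mul] and
    [R_id] say that these two matrices meet the side condition. *)
Lemma matrix_comeasuring_bialgebra : exists Delta eps,
  [/\ comeasuring_bialgebra Q (coact E u) Delta eps,
      unital_algmap Delta /\ unital_algmap eps,
      forall i j, Delta (u i j) = \sum_l u i l ⊗ u l j
    & forall i j, eps (u i j) = (i == j)%:R].
Proof.
have [Delta [aD Du]] := u_lift (comat_mul basisE E0 cu cu) R_mul.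
have [eps [ae eu]] := u_lift (comat_id basisE E0) R_id.
exists Delta, eps; split=> //; split; first exact: initial_matrix.
- exact: matrix_bialgebra u_ext aD ae Du eu.
- exact: matrix_coaction.
Qed.

End Initial.

(** * The universal matrices over M(A) and M_0(A) *)

Definition comeas_matrix : 'I_n.+1 -> 'I_n.+1 -> comeas_alg c :=
  block_matrix (comeas_b c) (comeas_t c).

Definition restr_matrix : 'I_n.+1 -> 'I_n.+1 -> restr_alg c :=
  block_matrix (fun=> 0) (restr_t c).

Lemma comat_comeas : comat E comeas_matrix.
Proof. exact/comat_blockP/comeas_relations_alg. Qed.

Lemma comat_restr : comat E restr_matrix.
Proof. exact/comat_blockP/restr_relations_alg. Qed.

Lemma comeas_matrix_lift (B : ualgType k) (v : 'I_n.+1 -> 'I_n.+1 -> B) :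
  comat E v -> exists f : comeas_alg c -> B,
    unital_algmap f /\ forall i j, f (comeas_matrix i j) = v i j.
Proof.
move=> cv; have vE := comat_block cv.
have [f [af fb ft]] := comeas_alg_lift ((comat_blockP _ _).1 (comat_ext vE cv)).
exists f; split=> // i j; rewrite block_matrix_morph // vE.
exact: block_matrix_ext.
Qed.

Lemma restr_matrix_lift (B : ualgType k) (v : 'I_n.+1 -> 'I_n.+1 -> B) :
  comat E v -> (forall j, v ord0 (up j) = 0) -> exists f : restr_alg c -> B,
    unital_algmap f /\ forall i j, f (restr_matrix i j) = v i j.
Proof.
move=> cv v0; have vE i j : v i j =
    block_matrix (fun=> 0) (fun i j => v (up i) (up j)) i j.
  by rewrite (comat_block cv); apply: block_matrix_ext.
have [f [af ft]] := restr_alg_lift ((comat_blockP _ _).1 (comat_ext vE cv)).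
exists f; split=> // i j; rewrite block_matrix_morph // vE.
by apply: block_matrix_ext => // _; rewrite (lin0 (algmap_lin af)).
Qed.

Lemma comeas_matrix_ext (B : ualgType k) (f g : comeas_alg c -> B) :
  unital_algmap f -> unital_algmap g ->
  (forall i j, f (comeas_matrix i j) = g (comeas_matrix i j)) -> f =1 g.
Proof.
move=> af ag fg; apply: comeas_alg_ext => // [i|i j].
- by have := fg ord0 (up i); rewrite /comeas_matrix block_matrixE.
- by have := fg (up i) (up j); rewrite /comeas_matrix block_matrixE.
Qed.

Lemma restr_matrix_ext (B : ualgType k) (f g : restr_alg c -> B) :
  unital_algmap f -> unital_algmap g ->
  (forall i j, f (restr_matrix i j) = g (restr_matrix i j)) -> f =1 g.
Proof.
move=> af ag fg; apply: restr_alg_ext => // i j.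
by have := fg (up i) (up j); rewrite /restr_matrix block_matrixE.
Qed.

Lemma comeas_bialgebra : exists Delta eps,
  [/\ comeasuring_bialgebra (any_comeasuring A) (coact E comeas_matrix) Delta eps,
      unital_algmap Delta /\ unital_algmap eps,
      forall i j, Delta (comeas_matrix i j)
                  = \sum_l comeas_matrix i l ⊗ comeas_matrix l j
    & forall i j, eps (comeas_matrix i j) = (i == j)%:R].
Proof.
apply: (matrix_comeasuring_bialgebra (R := fun _ _ => True)) => //.
- exact: comat_comeas.
- by move=> B v cv _; apply: comeas_matrix_lift.
- exact: comeas_matrix_ext.
Qed.

Lemma restr_bialgebra (P : {vspace A}) :
  (forall a, (a \in P) = (coord E ord0 a == 0)) ->
  exists Delta eps,
  [/\ comeasuring_bialgebra (respects_splitting (fun a => a \in P))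
        (coact E restr_matrix) Delta eps,
      unital_algmap Delta /\ unital_algmap eps,
      forall i j, Delta (restr_matrix i j)
                  = \sum_l restr_matrix i l ⊗ restr_matrix l j
    & forall i j, eps (restr_matrix i j) = (i == j)%:R].
Proof.
move=> PE; have r0 j : restr_matrix ord0 (up j) = 0.
  by rewrite /restr_matrix block_matrixE.
apply: (matrix_comeasuring_bialgebra
  (R := fun B v => forall j, v ord0 (up j) = 0)) => //.
- move=> B beta v bE; apply: iff_trans (respects_splittingP basisE v PE).
  by split=> resp a /resp; rewrite bE.
- exact: comat_restr.
- move=> j; rewrite big_ord_recl r0 pure0r add0r big1 // => i _.
  by rewrite r0 pure0l.
- exact: restr_matrix_lift.
- exact: restr_matrix_ext.
Qed.

(** * M_0(A) as a quotient of M(A) *)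

Lemma comeas_to_restr : exists p : comeas_alg c -> restr_alg c,
  unital_algmap p /\ forall i j, p (comeas_matrix i j) = restr_matrix i j.
Proof. exact/comeas_matrix_lift/comat_restr. Qed.

(** In the quotient the image of [comeas_matrix] has b = 0, so M_0(A) classifies it by a map [g].
    Both composites of [g] and [q] fix the entries of a universal matrix, hence are identities. *)
Lemma quot_comeas_restr (p : comeas_alg c -> restr_alg c) : unital_algmap p ->
  (forall i j, p (comeas_matrix i j) = restr_matrix i j) ->
  let q := quot_lift (S := @is_comeas_b k n c) p in
  [/\ unital_algmap q, bijective q & forall x, q (quot_proj _ x) = p x].
Proof.
move=> ap pm q; have pS x : is_comeas_b x -> p x = 0.
  case=> i ->; have := pm ord0 (up i).
  by rewrite /comeas_matrix /restr_matrix !block_matrixE.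
have aq : unital_algmap q by apply: quot_lift_algmap.
have qE x : q (quot_proj _ x) = p x by apply: quot_lift_proj.
split=> //.
have apr := quot_proj_algmap (@is_comeas_b k n c).
have [g [ag gm]] : exists g : restr_alg c -> quot_alg _ (@is_comeas_b k n c),
    unital_algmap g /\
    forall i j, g (restr_matrix i j) = quot_proj _ (comeas_matrix i j).
  apply: restr_matrix_lift; first exact: comat_morph comat_comeas.
  move=> j; rewrite /comeas_matrix block_matrixE.
  by apply: quot_proj_gen; exists j.
exists g.
- elim/quot_ind=> x; rewrite qE; move: x; apply: comeas_matrix_ext => //.
    exact: algmap_comp.
  by move=> i j; rewrite pm gm.
- apply: restr_matrix_ext; first exact: algmap_comp.
    exact: algmap_id.
  by move=> i j; rewrite gm qE pm.
Qed.

End Comeasurings.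

Theorem proposition2p4 (k : fieldType) (A : falgType k) (A' : {vspace A})
    (n : nat) (e : n.-tuple A)
    (split_sum : (<[1]> + A' = fullv)%VS)
    (split_direct : (<[1]> :&: A' = 0)%VS)
    (e_basis : basis_of A' e) :
  let c := sconst [tuple of 1 :: e] in
  let M := comeas_alg c in
  let b := comeas_b c in
  let t := comeas_t c in
  let M0 := restr_alg c in
  let t0 := restr_t c in
  exists (betaM : A -> A ⊗ M) (DeltaM : M -> M ⊗ M) (epsM : M -> k^o)
         (beta0 : A -> A ⊗ M0) (Delta0 : M0 -> M0 ⊗ M0) (eps0 : M0 -> k^o)
         (q : quot_alg M (@is_comeas_b k n c) -> M0),
    (* the comeasuring bialgebra M(A) *)
    [/\ comeasuring_bialgebra (any_comeasuring A) betaM DeltaM epsM,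
        forall i, betaM (tnth e i)
                  = 1 ⊗ b i + \sum_a tnth e a ⊗ t a i,
        (forall i j, DeltaM (t i j) = \sum_a t i a ⊗ t a j) /\
        (forall i, DeltaM (b i) = \sum_a b a ⊗ t a i + 1 ⊗ b i)
      & (forall i j, epsM (t i j) = (i == j)%:R) /\
        (forall i, epsM (b i) = 0)]
    /\
    (* the restricted comeasuring bialgebra M_0(A) *)
    [/\ comeasuring_bialgebra (respects_splitting (fun a => a \in A'))
          beta0 Delta0 eps0,
        forall i, beta0 (tnth e i) = \sum_a tnth e a ⊗ t0 a i,
        forall i j, Delta0 (t0 i j) = \sum_a t0 i a ⊗ t0 a j
      & forall i j, eps0 (t0 i j) = (i == j)%:R]
    /\
    (* M_0(A) is the quotient of M(A) by b_i = 0 *)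
    [/\ unital_algmap q /\ bijective q,
        forall i j, q (quot_proj _ (t i j)) = t0 i j,
        is_bialgebra_map DeltaM epsM Delta0 eps0
          (fun x => q (quot_proj _ x))
      & forall a, beta0 a = tmap id (fun x => q (quot_proj _ x)) (betaM a)].
Proof.
move=> c M b t M0 t0.
pose E := [tuple of 1 :: e]; pose up := @lift n.+1 ord0.
have E0 : tnth E ord0 = 1 by [].
have ES i : tnth E (up i) = tnth e i by rewrite !(tnth_nth 0).
have basisE : basis_of fullv E.
  rewrite /basis_of /= span_cons (span_basis e_basis) split_sum eqxx.
  rewrite free_cons (basis_free e_basis) andbT (span_basis e_basis).
  apply/negP => A'1; have : 1 \in (<[1]> :&: A')%VS by rewrite memv_cap memv_line.
  by rewrite split_direct memv0 oner_eq0.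
(* [A'] is spanned by [e], so belonging to it means having no component along 1; this is the form of
   the splitting that [restr_bialgebra] takes. *)
have A'E a : (a \in A') = (coord E ord0 a == 0).
  have lift_coord : \sum_j coord E (up j) a *: tnth e j \in A'.
    apply: memv_suml => j _; apply: memvZ.
    by rewrite (basis_mem e_basis) // mem_tnth.
  rewrite {1}[a](coord_expand basisE) big_ord_recl E0.
  under eq_bigr => j _ do rewrite ES.
  rewrite rpredDr //; apply/idP/eqP => [a1|->]; last by rewrite scale0r mem0v.
  have : coord E ord0 a *: 1 \in (<[1]> :&: A')%VS.
    by rewrite memv_cap a1 memvZ // memv_line.
  by rewrite split_direct memv0 scaler_eq0 oner_eq0 orbF => /eqP.
have [DeltaM [epsM [biM [aDM aeM] DM eM]]] := comeas_bialgebra basisE E0.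
have [Delta0 [eps0 [bi0 [aD0 ae0] D0 e0]]] := restr_bialgebra basisE E0 A'E.
have [p [ap pm]] := comeas_to_restr basisE E0.
have [aq bq qE] := quot_comeas_restr basisE E0 ap pm.
have aqp : unital_algmap (fun x => quot_lift p (quot_proj (@is_comeas_b k n c) x)).
  by apply: algmap_eq ap => x; rewrite qE.
exists (coact E (comeas_matrix E)), DeltaM, epsM.
exists (coact E (restr_matrix E)), Delta0, eps0, (quot_lift p).
split; [split=> // | split; split=> //].
- move=> i; rewrite -ES coact_basis // big_ord_recl E0.
  rewrite /comeas_matrix block_matrixE; congr (_ + _).
  by apply: eq_bigr => a _; rewrite block_matrixE -ES.
- split=> [i j|i].
    (* The summand l = 0 is [0 ⊗ b j], which leaves only the entries of [t]. *)
    have := DM (up i) (up j); rewrite big_ord_recl /comeas_matrix.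
    rewrite !block_matrixE pure0l add0r => ->.
    by apply: eq_bigr => a _; rewrite !block_matrixE.
  have := DM ord0 (up i); rewrite big_ord_recl /comeas_matrix.
  rewrite !block_matrixE addrC => ->; congr (_ + _).
  by apply: eq_bigr => a _; rewrite !block_matrixE.
- split=> [i j|i].
    have := eM (up i) (up j); rewrite /comeas_matrix block_matrixE => ->.
    by rewrite (inj_eq lift_inj).
  by have := eM ord0 (up i); rewrite /comeas_matrix block_matrixE.
- move=> i; rewrite -ES coact_basis // big_ord_recl.
  rewrite /restr_matrix block_matrixE pure0r add0r.
  by apply: eq_bigr => a _; rewrite block_matrixE -ES.
- move=> i j; have := D0 (up i) (up j); rewrite big_ord_recl /restr_matrix.
  rewrite !block_matrixE pure0l add0r => ->.
  by apply: eq_bigr => a _; rewrite !block_matrixE.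
- move=> i j; have := e0 (up i) (up j); rewrite /restr_matrix block_matrixE => ->.
  by rewrite (inj_eq lift_inj).
- move=> i j; rewrite qE.
  by have := pm (up i) (up j); rewrite /comeas_matrix /restr_matrix !block_matrixE.
(* Both compatibilities equate algebra maps out of M(A), so they are tested on the universal matrix,
   which [p] sends to that of M_0(A). *)
- split=> //; apply: comeas_matrix_ext => //.
  + exact: algmap_comp aD0 aqp.
  + exact: algmap_comp (tmap_algmap aqp aqp) aDM.
  + move=> i j; have lt := tmap_linear (algmap_lin aqp) (algmap_lin aqp).
    rewrite qE pm D0 DM (lin_sum lt); apply: eq_bigr => l _.
    by rewrite tmap_pure ?qE ?pm //; apply: algmap_lin.
  + exact: algmap_comp ae0 aqp.
  + by move=> i j; rewrite qE pm e0 eM.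
- move=> a; rewrite tmap_coact; last exact: algmap_lin.
  by apply: coact_ext => i j; rewrite qE pm.
Qed.
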